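(* Let $\mathbf t=(t_1,t_2)$ be a type, $r$ an integer, $h\in\mathscr F^{\mathbf t}_{r+|\mathbf t|}$ with real coefficients, and consider a real analytic planar system $\dot{\mathbf x}=\mathbf X_h+\text{q-h.h.o.t.}$ with a singular point at the origin. Then the origin is monodromic if and only if $h$ vanishes (on $\mathbb R^2$) only at the origin.
   Context: Type: $\mathbf t=(t_1,t_2)\neq(0,0)$, with $t_1,t_2$ non-negative integers without common factors; $|\mathbf t|=t_1+t_2$. $\mathscr P^{\mathbf t}_k$ is the space of $f\in\mathbb C[x,y]$ with $f(\varepsilon^{t_1}x,\varepsilon^{t_2}y)=\varepsilon^k f(x,y)$ (so $\mathscr P^{\mathbf t}_k=\{0\}$ for $k<0$). $\mathcal Q^{\mathbf t}_k$ is the space of polynomial vector fields $(P,Q)^T$ with $P\in\mathscr P^{\mathbf t}_{k+t_1}$, $Q\in\mathscr P^{\mathbf t}_{k+t_2}$. For $h\in\mathscr P^{\mathbf t}_{r+|\mathbf t|}$, $\mathbf X_h=(-\partial h/\partial y,\partial h/\partial x)^T\in\mathcal Q^{\mathbf t}_r$. ''q-h.h.o.t.'' means a sum of quasi-homogeneous terms of type $\mathbf t$ of degree strictly larger than $r$ (in $\mathcal Q^{\mathbf t}_k$, $k>r$). $\ell_j:\mathscr P^{\mathbf t}_{j-r}\to\mathscr P^{\mathbf t}_j$, $\ell_j(\mu)=\frac{\partial h}{\partial x}\frac{\partial\mu}{\partial y}-\frac{\partial h}{\partial y}\frac{\partial \mu}{\partial x}$. $\mathscr F^{\mathbf t}_{r+|\mathbf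 t|}$ is the set of $h\in\mathscr P^{\mathbf t}_{r+|\mathbf t|}$ such that (H1) the factorization of $h$ in $\mathbb C[x,y]$ has only simple factors, and (H2) $h\mathscr P^{\mathbf t}_j$ is a complementary subspace to the range of $\ell_{r+|\mathbf t|+j}$ for every $j\ge1$ such that $j\le r$ or $\mathscr P^{\mathbf t}_{j-r}=\{0\}$. A singular point is monodromic if it is surrounded by orbits of the system, i.e. the orbits near it turn around it, so that a first return map is defined on a section through it (no orbit leaves or enters the point with a definite tangent direction).
   Formalization: The case r = -|t| (h of quasi-homogeneous degree 0) is excluded, since there the claim fails: for t = (2,3), r = -5, h = 1 one has X_h = 0, and both a saddle and a centre are admissible systems. *)

(* Defs.v *)
From HB Require Import structures.
From mathcomp Require Import all_boot all_order all_algebra polyXY.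
From mathcomp Require Import all_classical all_reals all_analysis.
From mathcomp Require Import complex.

Set Implicit Arguments.
Unset Strict Implicit.
Unset Printing Implicit Defensive.

Import Order.TTheory GRing.Theory Num.Theory.
Import numFieldNormedType.Exports.

Local Open Scope classical_set_scope.
Local Open Scope ring_scope.

(* Bivariate polynomials are {poly {poly K}} with the conventions of polyXY:
   the outer indeterminate is x and the inner one is y, so that p.[x, y] is
   the value at (x, y) and p`_i`_j is the coefficient of x^i y^j. *)

Section QuasiHomogeneous.
Variable K : numFieldType.
Implicit Types (t : nat * nat) (k r j : int) (h mu p : {poly {poly K}}).

Definition is_type t : bool := (t != (0, 0)%N) && coprime t.1 t.2.

Definition twt t : int := (t.1 + t.2)%:Z.

(* eps ranges over nonzero scalars since k may be negative. *)
Definition qh t k : set {poly {poly K}} :=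
  [set f | forall eps x y : K, eps != 0 ->
     f.[eps ^+ t.1 * x, eps ^+ t.2 * y] = eps ^ k * f.[x, y]].

Definition qhvf t k : set ({poly {poly K}} * {poly {poly K}}) :=
  [set F | qh t (k + t.1%:Z) F.1 /\ qh t (k + t.2%:Z) F.2].

Definition dX p : {poly {poly K}} := p^`().
Definition dY p : {poly {poly K}} := map_poly (@deriv K) p.

Definition hamvf h : {poly {poly K}} * {poly {poly K}} := (- dY h, dX h).

Definition irreducible2 p : Prop :=
  [/\ p != 0, p \isn't a GRing.unit &
      forall a b : {poly {poly K}}, p = a * b ->
        a \is a GRing.unit \/ b \is a GRing.unit].

Definition simple_factors h : Prop :=
  h != 0 /\
  forall p, irreducible2 p -> ~ exists q : {poly {poly K}}, h = p ^+ 2 * q.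

Definition ell h mu : {poly {poly K}} := dX h * dY mu - dY h * dX mu.

(* The range of ell_j : P_(j - r) -> P_j, where h lies in P_(r + |t|). *)
Definition ell_range t r h j : set {poly {poly K}} :=
  [set ell h mu | mu in qh t (j - r)].

(* W is the internal direct sum of U and V. *)
Definition complementary (W U V : set {poly {poly K}}) : Prop :=
  W = [set u + v | u in U & v in V] /\ U `&` V = [set 0].

Definition Fclass t r : set {poly {poly K}} :=
  [set h | [/\ qh t (r + twt t) h,
               simple_factors h &
               forall j : int, 1 <= j -> (j <= r \/ qh t (j - r) = [set 0]) ->
                 complementary (qh t (r + twt t + j))
                   [set h * g | g in qh t j]
                   (ell_range t r h (r + twt t + j))]].

End QuasiHomogeneous.

Section PlanarSystems.
Variable R : realType.
Implicit Types (t : nat * nat) (r : int) (h p : {poly {poly R}}).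
Implicit Types (f g : R -> R -> R) (c : nat -> nat -> R).

Definition complexify p : {poly {poly R[i]}} :=
  map_poly (map_poly (real_complex R)) p.

(* f is real analytic at the origin and its Taylor series there is
   \sum_(i, j) c i j x^i y^j.  As the double series converges absolutely,
   summing over squares is no restriction. *)
Definition has_expansion f c : Prop :=
  exists2 rho : R, 0 < rho &
    (exists M : R, forall n : nat,
       \sum_(i < n) \sum_(j < n) `|c i j| * rho ^+ (i + j) <= M) /\
    (forall x y : R, `|x| < rho -> `|y| < rho ->
       (\sum_(i < n) \sum_(j < n) c i j * x ^+ i * y ^+ j) @[n --> \oo]
         --> f x y).

(* c is the coefficient family of the formal series p + \sum_n u n. *)
Definition formal_sum p (u : nat -> {poly {poly R}}) c : Prop :=
  forall i j : nat,
    \forall N \near \oo, c i j = p`_i`_j + \sum_(n < N) (u n)`_i`_j.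

(* The system x' = f(x, y), y' = g(x, y) is analytic at the origin and reads
   X_h + \sum_(k > r) (u k, v k) with (u k, v k) a real element of Q_k; the
   term of degree k = r + n + 1 is stored at the index n. *)
Definition hamiltonian_plus_hot t r h f g : Prop :=
  exists u v : nat -> {poly {poly R}},
    (forall n : nat, qhvf t (r + n.+1%:Z) (complexify (u n), complexify (v n)))
    /\ (exists2 c, has_expansion f c & formal_sum (hamvf h).1 u c)
    /\ (exists2 d, has_expansion g d & formal_sum (hamvf h).2 v d).

Definition solution_on f g (T : R) (x y : R -> R) : Prop :=
  [/\ {within `[0, T], continuous x}, {within `[0, T], continuous y} &
      forall s : R, 0 < s < T ->
        is_derive s 1 x (f (x s) (y s)) /\ is_derive s 1 y (g (x s) (y s))].

(* The forward orbit of (a, b) makes a complete turn around the origin while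
   staying at distance in ]0, eps[ from it: rho and theta are polar
   coordinates along the orbit, theta being a continuous determination of the
   angle. *)
Definition turns_within f g (eps a b : R) : Prop :=
  exists (T : R) (x y rho theta : R -> R),
    [/\ 0 < T, x 0 = a /\ y 0 = b & solution_on f g T x y] /\
    [/\ {within `[0, T], continuous theta},
        forall s : R, 0 <= s <= T ->
          [/\ 0 < rho s < eps, x s = rho s * cos (theta s) &
              y s = rho s * sin (theta s)] &
        `|theta T - theta 0| = 2 * pi].

(* All orbits near the origin turn around it.  After the full turn the orbit
   is back on the half-line from the origin through (a, b), so every such
   half-line carries a first return map near the origin.  The turn has to
   take place inside an arbitrary prescribed disc: monodromy is a property of
   the germ (the saddle of a figure-eight loop is surrounded by large orbits
   passing arbitrarily close to it, but it is not monodromic). *)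
Definition monodromic f g : Prop :=
  forall eps : R, 0 < eps ->
    exists2 delta : R, 0 < delta &
      forall a b : R, 0 < a ^+ 2 + b ^+ 2 < delta ^+ 2 ->
        turns_within f g eps a b.

Definition vanishes_only_at_origin h : Prop :=
  forall x y : R, h.[x, y] = 0 <-> x = 0 /\ y = 0.

End PlanarSystems.

(* Main.v *)
Require Import Defs.
From HB Require Import structures.
From mathcomp Require Import all_boot all_order all_algebra polyXY.
From mathcomp Require Import all_classical all_reals all_analysis.
From mathcomp Require Import complex.
From mathcomp Require Import zify ring lra.
Import Order.TTheory GRing.Theory Num.Theory.
Import numFieldNormedType.Exports.
Set Implicit Arguments.
Unset Strict Implicit.
Unset Printing Implicit Defensive.
Local Open Scope classical_set_scope.
Local Open Scope ring_scope.

(** Write w = r + |t|, and let the orbits be described in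
    weighted polar coordinates x = rho ^ t1 cos phi, y = rho ^ t2 sin phi.  The
    convergent series of f and g then become rho ^ (w - t2) A1 and
    rho ^ (w - t1) A2 with A1 and A2 Lipschitz up to rho = 0, where they reduce to
    - h_y and h_x ([blow_up_exists]).  Up to a positive factor the angular speed is
    therefore t1 x h_x + t2 y h_y + O(rho) = w h + O(rho), by Euler's identity, and
    the sign of h on a weighted ray tells in which direction the flow crosses this
    ray close to the origin ([blow_up_turns_like]).

    If h vanishes only at the origin, it has a constant sign on the unit circle, the
    angular speed is bounded away from zero, and ln rho is a solution of a scalar
    equation d (ln rho) / d phi = G with G bounded and Lipschitz.  Picard iteration
    solves it over two full turns of phi ([picard]); the time is an antiderivative
    of the inverse of the angular speed, and inverting it yields an orbit of the
    system ([inverse_function]).  Since G is bounded, an orbit which starts close to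
    the origin stays close to it.  The polar angle differs from phi by less than a
    quarter turn, so it makes an exact full turn ([definite_monodromic]).

    Suppose conversely that the origin is monodromic and that t1 and t2 are positive.
    If h were positive on one ray and negative on a later ray of the same open
    half-plane, the sector between the two rays could not be left: the flow enters
    it through both sides ([sector_trap]).  Orbits inside would never turn.  Hence a
    positive value of h propagates counterclockwise from each half-plane to the
    next, and h is nonnegative everywhere as soon as it is positive somewhere
    ([rotating_semidefinite]).  But a semidefinite h with a real zero other than the
    origin has a repeated factor: the polynomial x, y, or
    y0 ^ t1 x ^ t2 - x0 ^ t2 y ^ t1 which vanishes on the curve through this zero
    divides every quasi-homogeneous polynomial that vanishes there, it changes sign
    across the curve, so its cofactor in h must vanish on the curve as well
    ([semidefinite_square]).  This contradicts the simplicity of the factors.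

    The types (1, 0) and (0, 1) remain.  There h vanishes on a whole coordinate
    axis, and this axis is invariant under the flow, so that the origin is not
    monodromic ([invariant_axis_absurd]). *)

(** * Quasi-homogeneous polynomials *)

(** Quasi-homogeneity read off the coefficients, which is what is needed both for
    factoring polynomials and for comparing them with power series. *)
Definition quasihom (K : nzRingType) (t : nat * nat) (k : int)
    (p : {poly {poly K}}) : Prop :=
  forall i j, p`_i`_j != 0 -> (t.1 * i + t.2 * j)%N%:Z = k.

Definition monom (K : nzRingType) (c : K) (i j : nat) : {poly {poly K}} :=
  (c *: 'X^j) *: 'X^i.

Section Bivariate.
Variable K : idomainType.
Implicit Types (p q h : {poly {poly K}}) (t : nat * nat) (k l : int).

Lemma coef_monom (c : K) i j i' j' :
  (monom c i j)`_i'`_j' = c *+ ((i' == i) && (j' == j)).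
Proof.
rewrite /monom coefZ coefXn; case: (i' == i) => /=; last by rewrite mulr0 coef0 mulr0n.
by rewrite mulr1 coefZ coefXn mulr_natr.
Qed.

Lemma monomM (a b : K) i j i' j' :
  monom a i j * monom b i' j' = monom (a * b) (i + i') (j + j').
Proof.
by rewrite /monom !exprD -!mul_polyC !polyCM; ring.
Qed.

Lemma horner_monom (c : K) i j x y : (monom c i j).[x, y] = c * x ^+ i * y ^+ j.
Proof.
rewrite /monom hornerZ hornerXn hornerM hornerZ hornerXn -rmorphXn hornerC.
by ring.
Qed.

Lemma quasihom_monom t (c : K) i j : quasihom t (t.1 * i + t.2 * j)%N%:Z (monom c i j).
Proof.
move=> i' j'; rewrite coef_monom.
by case: (i' =P i) => [->|_]; case: (j' =P j) => [->|_]; rewrite ?mulr0n ?eqxx.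
Qed.

Lemma quasihom0 t k : quasihom t k (0 : {poly {poly K}}).
Proof. by move=> i j; rewrite !coef0 eqxx. Qed.

Lemma quasihomD t k p q : quasihom t k p -> quasihom t k q -> quasihom t k (p + q).
Proof.
move=> hp hq i j; rewrite !coefD; have [->|/hp //] := eqVneq p`_i`_j 0.
by rewrite add0r => /hq.
Qed.

Lemma quasihomN t k p : quasihom t k p -> quasihom t k (- p).
Proof. by move=> hp i j; rewrite !coefN oppr_eq0 => /hp. Qed.

Lemma sum_neq0 (A : nmodType) (I : finType) (F : I -> A) :
  \sum_i F i != 0 -> exists i, F i != 0.
Proof.
move=> /eqP s0; apply/existsP; rewrite -[X in is_true X]negbK negb_exists.
by apply/negP => /forallP F0; apply: s0; apply: big1 => i _; apply/eqP/negPn/F0.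
Qed.

Lemma quasihomM t k l p q : quasihom t k p -> quasihom t l q -> quasihom t (k + l) (p * q).
Proof.
move=> hp hq i j; rewrite coefM coef_sum => /sum_neq0[a].
rewrite coefM => /sum_neq0[b]; rewrite mulf_eq0 negb_or => /andP[/hp hk /hq hl].
have := ltn_ord a; have := ltn_ord b; rewrite !ltnS => bj ai.
by rewrite -hk -hl -PoszD; congr Posz; nia.
Qed.

Lemma quasihom_swapXY t k p : quasihom t k p -> quasihom (t.2, t.1) k (swapXY p).
Proof. by move=> hp i j; rewrite coef_swapXY => /hp <- /=; rewrite addnC. Qed.

Lemma horner2E p n x y : (size p <= n)%N -> (sizeY p <= n)%N ->
  p.[x, y] = \sum_(i < n) \sum_(j < n) p`_i`_j * x ^+ i * y ^+ j.
Proof.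
move=> sp sY; rewrite (horner_coef_wide _ sp) horner_sum; apply: eq_bigr => i _.
rewrite -rmorphXn hornerM hornerC (horner_coef_wide _ (leq_trans (max_size_coefXY _ _) sY)).
by rewrite mulr_suml; apply: eq_bigr => j _; rewrite mulrAC.
Qed.

Lemma poly_seq_roots (A : idomainType) (p : {poly A}) (u : nat -> A) :
  injective u -> (forall n, p.[u n] = 0) -> p = 0.
Proof.
move=> inj p0; apply: (@roots_geq_poly_eq0 _ _ [seq u n | n <- iota 0 (size p)]).
- by apply/allP => _ /mapP[n _ ->]; apply/eqP.
- by rewrite map_inj_uniq ?iota_uniq.
- by rewrite size_map size_iota.
Qed.

End Bivariate.

Section OverNumField.
Variable K : numFieldType.
Implicit Types (p q h : {poly {poly K}}) (t : nat * nat) (k l : int).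

Lemma bipoly_grid_eq0 p (a b : nat -> K) : injective a -> injective b ->
  (forall m n, p.[a m, b n] = 0) -> p = 0.
Proof.
move=> ia ib p0; apply: (@poly_seq_roots _ _ (fun m => (a m)%:P)).
  by move=> m n /polyC_inj /ia.
by move=> m; apply: poly_seq_roots ib _ => n; exact: p0.
Qed.

Lemma bipoly_eq0 p : (forall x y : K, p.[x, y] = 0) -> p = 0.
Proof.
have injK : injective (fun n : nat => n%:R : K) by move=> m n /eqP; rewrite eqr_nat => /eqP.
by move=> p0; apply: (bipoly_grid_eq0 injK injK) => m n.
Qed.

(** One scalar suffices: with eps = 2 the powers 2 ^ k are pairwise distinct, so
    comparing coefficients isolates the monomials of weight k. *)
Lemma qh_quasihom t k p : qh t k p -> quasihom t k p.
Proof.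
move=> hp i j pij.
pose n := maxn (size p) (sizeY p).
pose q : {poly {poly K}} :=
  \poly_(i < n) \poly_(j < n) (2 ^+ (t.1 * i + t.2 * j) * p`_i`_j).
have nX : (size p <= n)%N by rewrite leq_maxl.
have nY : (sizeY p <= n)%N by rewrite leq_maxr.
have qE : q = (2 ^ k)%:P *: p.
  apply/eqP; rewrite -subr_eq0; apply/eqP/bipoly_eq0 => x y.
  rewrite hornerD hornerD hornerN hornerN hornerZ hornerM hornerC.
  rewrite -hp ?pnatr_eq0 // (horner2E _ _ nX nY).
  apply/eqP; rewrite subr_eq0; apply/eqP.
  rewrite (@horner2E _ q n); last 2 first.
  - exact: size_poly.
  - by apply/bigmax_leqP => l _; rewrite coef_poly; case: ifP => _;
      rewrite ?size_poly // size_poly0.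
  apply: eq_bigr => a _; apply: eq_bigr => b _.
  by rewrite coef_poly ltn_ord coef_poly ltn_ord !exprMn !exprD !exprM; ring.
have ilt : (i < n)%N.
  rewrite ltnNge; apply: contra pij => ni; rewrite (nth_default _ (leq_trans nX ni)).
  by rewrite coef0.
have jlt : (j < n)%N.
  rewrite ltnNge; apply: contra pij => nj.
  by rewrite (nth_default _ (leq_trans (leq_trans (max_size_coefXY _ _) nY) nj)).
have := congr1 (fun u : {poly {poly K}} => u`_i`_j) qE.
rewrite coef_poly ilt coef_poly jlt coefZ coefCM => /(mulIf pij).
have nat2 (a b : nat) : 2 ^+ a = 2 ^+ b :> K -> a = b.
  by rewrite -!natrX => /eqP; rewrite eqr_nat eqn_exp2l // => /eqP.
case: k {hp q qE} => [l /nat2 ->//|l /(congr1 ( *%R^~ (2 ^+ l.+1)))].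
rewrite NegzE -exprnN mulVf ?expf_neq0 ?pnatr_eq0 // -exprD -(expr0 2) => /nat2.
by lia.
Qed.

End OverNumField.

(** * Partial derivatives and Euler's identity *)

Section Derivatives.
Variable K : idomainType.
Implicit Types (p h : {poly {poly K}}) (t : nat * nat) (k : int).

Lemma quasihom_dX t k h : quasihom t k h -> quasihom t (k - t.1%:Z) (h^`() : {poly {poly K}}).
Proof.
move=> hh i j; rewrite coef_deriv coefMn => hij.
have /hh <- : h`_i.+1`_j != 0 by apply: contra_neq hij => ->; rewrite mul0rn.
by rewrite mulnS; lia.
Qed.

Lemma coef_dY h i j : (map_poly (@deriv K) h)`_i`_j = h`_i`_j.+1 *+ j.+1.
Proof. by rewrite coef_map coef_deriv. Qed.

Lemma quasihom_dY t k h : quasihom t k h -> quasihom t (k - t.2%:Z) (map_poly (@deriv K) h).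
Proof.
move=> hh i j; rewrite coef_dY => hij.
have /hh <- : h`_i`_j.+1 != 0 by apply: contra_neq hij => ->; rewrite mul0rn.
by rewrite mulnS; lia.
Qed.

Lemma quasihom_euler t (n : nat) h x y : quasihom t n%:Z h ->
  t.1%:R * x * (h^`()).[x, y] + t.2%:R * y * (map_poly (@deriv K) h).[x, y]
  = n%:R * h.[x, y].
Proof.
move=> hh.
have E : h^`() * 'X *+ t.1 + map_poly (@deriv K) h * 'Y *+ t.2 = h *+ n.
  apply/polyP => i; apply/polyP => j.
  rewrite !(coefD, coefMn, coefMX, coefMC).
  have L : (if i == 0%N then 0 else h^`()`_i.-1 : {poly K})`_j = h`_i`_j *+ i.
    by case: i => [|i] /=; rewrite ?coef0 ?mulr0n // coef_deriv coefMn.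
  have M : (if j == 0%N then 0 else (map_poly (@deriv K) h)`_i`_j.-1) = h`_i`_j *+ j.
    by case: j {L} => [|j] /=; rewrite ?mulr0n // coef_dY.
  rewrite L M -!mulrnA -mulrnDr.
  have [->|/hh [e]] := eqVneq (h`_i`_j) 0; first by rewrite !mul0rn.
  by congr (_ *+ _); rewrite -e; lia.
have := congr1 (fun u : {poly {poly K}} => u.[x, y]) E.
rewrite !(hornerD, hornerMn, hornerM, hornerX, hornerC) => E'.
rewrite [RHS]mulr_natl -E'; move: (horner _ _) (horner _ _) => A B.
by by rewrite -[B * x *+ _]mulr_natl -[A * y *+ _]mulr_natl; ring.
Qed.

Lemma quasihom_scale t (n : nat) h (r x y : K) : quasihom t n%:Z h ->
  h.[r ^+ t.1 * x, r ^+ t.2 * y] = r ^+ n * h.[x, y].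
Proof.
move=> hh; pose N := maxn (size h) (sizeY h).
rewrite !(@horner2E _ h N) ?leq_maxl ?leq_maxr // mulr_sumr; apply: eq_bigr => i _.
rewrite mulr_sumr; apply: eq_bigr => j _.
have [->|/hh [<-]] := eqVneq (h`_i`_j) 0; first by rewrite !mul0r mulr0.
by rewrite !exprMn exprD !exprM; ring.
Qed.

End Derivatives.

(** * Irreducible factors and repeated factors *)

Section Irreducible.
Variable K : numFieldType.
Implicit Types (p q a b : {poly {poly K}}).

(** This degree is additive on products and vanishes exactly on units, which is
    all that the descent below needs. *)
Definition lexdeg p : nat := ((size p).-1 + (size (lead_coef p)).-1)%N.

Lemma lexdegM a b : a != 0 -> b != 0 -> lexdeg (a * b) = (lexdeg a + lexdeg b)%N.
Proof.
move=> a0 b0; rewrite /lexdeg lead_coefM.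
have sz p : p != 0 -> (0 < size p)%N /\ (0 < size (lead_coef p))%N.
  by move=> p0; rewrite !size_poly_gt0 lead_coef_eq0.
have -> : size (a * b) = (size a + size b).-1 by rewrite size_mul.
have -> : size (lead_coef a * lead_coef b) = (size (lead_coef a) + size (lead_coef b)).-1.
  by rewrite size_mul // lead_coef_eq0.
have := sz a a0; have := sz b b0.
by move: (size a) (size b) (size (lead_coef a)) (size (lead_coef b)) => *; lia.
Qed.

Lemma lexdeg_unit a : a != 0 -> lexdeg a = 0%N -> a \is a GRing.unit.
Proof.
move=> a0; rewrite /lexdeg => /eqP; rewrite addn_eq0 => /andP[/eqP s1 /eqP s2].
have sa : (size a <= 1)%N by have := a0; rewrite -size_poly_gt0; lia.
have [c aE] : exists c : {poly K}, a = c%:P by exists (a`_0); exact: size1_polyC.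
move: s2 a0; rewrite {}aE lead_coefC polyC_eq0 => s2 c0.
have sc : (size c <= 1)%N by have := c0; rewrite -size_poly_gt0; lia.
have [e cE] : exists e : K, c = e%:P by exists (c`_0); exact: size1_polyC.
move: c0; rewrite cE polyC_eq0 => e0.
by rewrite !rmorph_unit // unitfE.
Qed.

(** Descent on the degree above: a reducible polynomial has a factor of smaller
    positive degree. *)
Lemma irreducible_factor p : p != 0 -> p \isn't a GRing.unit ->
  exists q a, irreducible2 q /\ p = q * a.
Proof.
have [n] := ubnP (lexdeg p); elim: n => // n IH in p *; rewrite ltnS => pn p0 pu.
have [irr|nirr] := pselect (irreducible2 p).
  by exists p, 1; rewrite mulr1.
have [a [b [pab au bu]]] : exists a b, [/\ p = a * b, a \isn't a GRing.unit
    & b \isn't a GRing.unit].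
  apply: contrapT => H; apply: nirr; split => // a b pab.
  have [au|au] := boolP (a \is a GRing.unit); first by left.
  have [bu|bu] := boolP (b \is a GRing.unit); first by right.
  by case: H; exists a, b.
move: (p0); rewrite pab mulf_eq0 negb_or => /andP[a0 b0].
have b1 : (0 < lexdeg b)%N.
  by rewrite lt0n; apply: contra bu => /eqP; exact: lexdeg_unit.
move: pn; rewrite pab lexdegM // => pn.
have [|q [c [irr aE]]] := IH a _ a0 au; first by lia.
by exists q, (c * b); rewrite mulrA -aE.
Qed.

(** The square of any polynomial with a zero, irreducible or not, is excluded: such
    a polynomial is not a unit, hence it has an irreducible factor. *)
Lemma simple_factors_square h p q (x y : K) :
  simple_factors h -> p.[x, y] = 0 -> h <> q * p ^+ 2.
Proof.
move=> [h0 simp] pz hE.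
have p0 : p != 0 by apply: contra_neq h0 => p0; rewrite hE p0 expr0n mulr0.
have pu : p \isn't a GRing.unit.
  apply/negP => pu; have := congr1 (fun u : {poly {poly K}} => u.[x, y]) (mulrV pu).
  by rewrite !hornerM pz mul0r !hornerC => /eqP; rewrite eq_sym oner_eq0.
have [s [a [irr pE]]] := irreducible_factor p0 pu.
by apply: (simp s irr); exists (a ^+ 2 * q); rewrite hE pE; ring.
Qed.

End Irreducible.

(** * The binomial attached to a zero off the axes *)

(** Two exponents of x in a given weight are congruent modulo b. *)
Lemma weight_inj (a b i j i' j' : nat) : coprime a b -> (0 < b)%N ->
  (i < b)%N -> (i' < b)%N -> (a * i + b * j = a * i' + b * j')%N -> i = i' /\ j = j'.
Proof.
move=> ab b0; wlog ii' : i j i' j' / (i <= i')%N => [W ib ib' e|ib ib' e].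
  by case: (leqP i i') => [le|/ltnW le]; [|move: (W i' j' i j le ib' ib (esym e)) => -[-> ->]];
    [exact: W|].
have : (b %| a * (i' - i))%N.
  apply/dvdnP; exists (j - j')%N; rewrite mulnBr; nia.
rewrite Gauss_dvdr; last by rewrite coprime_sym.
move=> /dvdnP[[|c]]; last by move=> c1; nia.
move=> i0; have ii : i = i' by lia.
by split=> //; move: e; rewrite ii => /addnI/eqP; rewrite eqn_pmul2l // => /eqP.
Qed.

Section ZeroFactor.
Variable K : fieldType.
Implicit Types (p q h : {poly {poly K}}) (t : nat * nat) (k : int).

Definition binomXY t (x0 y0 : K) : {poly {poly K}} :=
  monom (y0 ^+ t.1) t.2 0 - monom (x0 ^+ t.2) 0 t.1.

Lemma quasihom_binomXY t x0 y0 : quasihom t (t.1 * t.2)%N%:Z (binomXY t x0 y0).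
Proof.
apply: quasihomD; last apply: quasihomN.
  by have := @quasihom_monom K t (y0 ^+ t.1) t.2 0; rewrite muln0 addn0.
by have := @quasihom_monom K t (x0 ^+ t.2) 0 t.1; rewrite muln0 add0n mulnC.
Qed.

Lemma horner_binomXY t x0 y0 x y :
  (binomXY t x0 y0).[x, y] = y0 ^+ t.1 * x ^+ t.2 - x0 ^+ t.2 * y ^+ t.1.
Proof.
by rewrite /binomXY hornerD hornerN hornerD hornerN !horner_monom !expr0 !mulr1.
Qed.

(** Modulo the binomial every monomial reduces to degree less than t2 in x, and
    there is at most one such monomial of a given weight because t1 and t2 are coprime; a
    single monomial that vanishes off the axes is zero.  The division is carried
    out one leading monomial at a time, so that quotients stay homogeneous. *)
Lemma binomXY_factor t k h x0 y0 : (0 < t.1)%N -> (0 < t.2)%N -> coprime t.1 t.2 ->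
  x0 != 0 -> y0 != 0 -> quasihom t k h -> h.[x0, y0] = 0 ->
  exists2 q, quasihom t (k - (t.1 * t.2)%N%:Z) q & h = q * binomXY t x0 y0.
Proof.
move=> t1 t2 cop x00 y00; have [m] := ubnP (size h).
elim: m => // m IH in h *; rewrite ltnS => hm hh hz.
have [hs|hs] := leqP (size h) t.2.
  suff -> : h = 0 by exists 0; [exact: quasihom0|rewrite mul0r].
  apply/eqP/negPn/negP => h0.
  have [i [j hij]] : exists i j, h`_i`_j != 0.
    exists (size h).-1, (size (lead_coef h)).-1.
    by rewrite -[_`_(size h).-1]/(lead_coef h) -[_`_(_).-1]/(lead_coef _) !lead_coef_eq0.
  have ilt i' j' : h`_i'`_j' != 0 -> (i' < t.2)%N.
    move=> hij'; rewrite ltnNge; apply: contra hij' => le.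
    by rewrite (nth_default _ (leq_trans hs le)) coef0.
  have hE : h = monom h`_i`_j i j.
    apply/polyP => i'; apply/polyP => j'; rewrite coef_monom.
    have [hij'|hij'] := eqVneq (h`_i'`_j') 0.
      rewrite hij'; case: (i' =P i) => [ii|_]; case: (j' =P j) => [jj|_] //=.
      by rewrite mulr1n -ii -jj.
    case: (weight_inj cop t2 (ilt _ _ hij') (ilt _ _ hij) (j := j') (j' := j)).
      by have := hh _ _ hij'; have := hh _ _ hij => <- [].
    by move=> -> ->; rewrite !eqxx.
  move: hz; rewrite hE horner_monom => /eqP.
  by rewrite !mulf_eq0 !expf_eq0 (negPf hij) (negPf x00) (negPf y00) !andbF.
have h0 : h != 0 by rewrite -size_poly_gt0; lia.
pose i := (size h).-1; pose j := (size (lead_coef h)).-1.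
have si : size h = i.+1 by rewrite /i prednK // size_poly_gt0.
pose c := h`_i`_j.
have ci : h`_i = c *: 'X^j.
  apply/polyP => j'; rewrite coefZ coefXn.
  have [->|] := eqVneq j' j; first by rewrite mulr1.
  move=> jj'; rewrite mulr0; apply/eqP/negPn/negP => hij'.
  have hij : h`_i`_j != 0.
    by rewrite -[h`_i]/(lead_coef h) -[_`_j]/(lead_coef _) !lead_coef_eq0.
  have := hh _ _ hij'; rewrite -(hh _ _ hij) => -[] /addnI/eqP.
  by rewrite eqn_pmul2l // (negPf jj').
have cn0 : c != 0.
  by rewrite /c -[h`_i]/(lead_coef h) -[_`_j]/(lead_coef _) !lead_coef_eq0.
have it : (t.2 <= i)%N by rewrite /i; lia.
have yt0 : y0 ^+ t.1 != 0 by rewrite expf_neq0.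
pose u := monom (c / y0 ^+ t.1) (i - t.2) j.
have uE : u * binomXY t x0 y0 =
    monom c i j - monom (c / y0 ^+ t.1 * x0 ^+ t.2) (i - t.2) (j + t.1).
  by rewrite /u /binomXY mulrBr !monomM subnK // !addn0 divfK.
have hu : quasihom t (k - (t.1 * t.2)%N%:Z) u.
  have -> : k - (t.1 * t.2)%N%:Z = (t.1 * (i - t.2) + t.2 * j)%N%:Z.
    by rewrite -(hh i j cn0); nia.
  exact: quasihom_monom.
have hub : quasihom t k (u * binomXY t x0 y0).
  by rewrite -[k](subrK (t.1 * t.2)%N%:Z); apply: quasihomM => //; exact: quasihom_binomXY.
have [|||q hq qE] := IH (h - u * binomXY t x0 y0).
- rewrite (leq_trans _ hm) // si ltnS; apply/leq_sizeP => i' ii'; apply/polyP => j'.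
  rewrite uE !(coefD, coefN) !coef_monom coef0.
  have -> /= : (i' == i - t.2)%N = false by apply/negP => /eqP; lia.
  rewrite mulr0n subr0; have [->|ni] := eqVneq i' i.
    rewrite ci coefZ coefXn mulr_natr /=.
    by case: (_ == _); rewrite ?mulr1n ?mulr0n subrr.
  have -> : h`_i' = 0 by apply: nth_default; rewrite si ltn_neqAle eq_sym ni.
  by rewrite coef0 mulr0n subrr.
- by apply: quasihomD => //; exact: quasihomN.
- rewrite !(hornerD, hornerN) hz hornerM hornerM horner_binomXY.
  by rewrite [_ * x0 ^+ _]mulrC subrr mulr0 subr0.
by exists (q + u); [exact: quasihomD|rewrite mulrDl -qE subrK].
Qed.

(** The y-axis carries a single monomial of each weight, y ^ j, so a zero on it
    other than the origin kills all of h (0, y). *)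
Lemma X_factor t k h y0 : (0 < t.2)%N -> y0 != 0 -> quasihom t k h ->
  h.[0, y0] = 0 -> exists2 q, quasihom t (k - t.1%:Z) q & h = q * 'X.
Proof.
move=> t2 y00 hh hz.
have h0 : h`_0 = 0.
  apply/eqP/negPn/negP => h0.
  pose j := (size h`_0).-1.
  have hj : h`_0`_j != 0 by rewrite -[_`_j]/(lead_coef _) lead_coef_eq0.
  have hE : h`_0 = h`_0`_j *: 'X^j.
    apply/polyP => j'; rewrite coefZ coefXn; have [->|jj'] := eqVneq j' j.
      by rewrite mulr1.
    rewrite mulr0; apply/eqP/negPn/negP => hij'.
    have := hh _ _ hij'; rewrite -(hh _ _ hj) => -[] /addnI/eqP.
    by rewrite eqn_pmul2l // (negPf jj').
  move: hz; rewrite -horner_coef0 in hE hj *.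
  rewrite hE hornerZ hornerXn => /eqP.
  by rewrite mulf_eq0 expf_eq0 (negPf hj) (negPf y00) andbF.
have /factor_theorem[q] : root h 0 by apply/eqP; rewrite horner_coef0.
rewrite subr0 => hE; exists q => // i j qij.
have := hh i.+1 j; rewrite hE coefMX /= => /(_ qij) <-; rewrite mulnS; lia.
Qed.

End ZeroFactor.

(** * Semidefinite quasi-homogeneous polynomials *)

Section Semidefinite.
Variable R : realType.
Implicit Types (p q h : {poly {poly R}}) (t : nat * nat) (k : int).

Definition crosses_zero (f : R -> R) (x0 : R) : Prop :=
  forall e, 0 < e -> exists x1 x2, [/\ `|x1 - x0| < e, `|x2 - x0| < e & f x1 * f x2 < 0].

Lemma crosses_zero_id : crosses_zero id 0.
Proof.
move=> e e0; exists (e / 2), (- (e / 2)); split=> /=.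
- by rewrite subr0 gtr0_norm; lra.
- by rewrite subr0 normrN gtr0_norm; lra.
- by rewrite mulrN oppr_lt0 mulr_gt0 // divr_gt0.
Qed.

(** The witnesses are x0 (1 + d) and x0 (1 - d), whose n-th powers lie on the two
    sides of x0 ^ n in absolute value, whatever the parity of n. *)
Lemma crosses_zero_exprn (n : nat) (c x0 : R) : (0 < n)%N -> c != 0 -> x0 != 0 ->
  crosses_zero (fun x => c * x ^+ n - x0 ^+ n * c) x0.
Proof.
move=> n0 c0 x00 e e0.
have x0p : 0 < `|x0| by rewrite normr_gt0.
pose d := Num.min (1 / 2) (e / 2 / `|x0|).
have d0 : 0 < d by rewrite lt_min; apply/andP; split; rewrite ?divr_gt0 //.
have d1 : d < 1 by rewrite gt_min; apply/orP; left; lra.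
have de : d * `|x0| < e.
  apply: (@le_lt_trans _ _ (e / 2)); last lra.
  by rewrite -ler_pdivlMr // ge_min lexx orbT.
exists (x0 * (1 + d)), (x0 * (1 - d)); split.
- have -> : x0 * (1 + d) - x0 = d * x0 by ring.
  by rewrite normrM (gtr0_norm d0).
- have -> : x0 * (1 - d) - x0 = - (d * x0) by ring.
  by rewrite normrN normrM (gtr0_norm d0).
- rewrite !exprMn.
  have -> : (c * (x0 ^+ n * (1 + d) ^+ n) - x0 ^+ n * c) *
    (c * (x0 ^+ n * (1 - d) ^+ n) - x0 ^+ n * c) =
    (c * x0 ^+ n) ^+ 2 * (((1 + d) ^+ n - 1) * ((1 - d) ^+ n - 1)) by ring.
  rewrite pmulr_rlt0 ?exprn_even_gt0 //=; last by rewrite mulf_neq0 // expf_neq0.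
  rewrite pmulr_rlt0 ?subr_lt0 ?subr_gt0.
    by rewrite exprn_ilt1 -?lt0n //; lra.
  by rewrite exprn_egt1 -?lt0n //; lra.
Qed.

(** Where the other factor does not vanish it keeps its sign, and the crossing
    factor would make the product change sign. *)
Lemma cofactor_vanishes (p q : {poly R}) (x0 : R) :
  crosses_zero (horner p) x0 -> (forall x, 0 <= (q * p).[x]) -> q.[x0] = 0.
Proof.
move=> cr pos; apply/eqP/negPn/negP => q0.
have cq : {for x0, continuous (horner q)}.
  exact: continuous_horner.
have := cq => /cvgrPdist_lt /(_ `|q.[x0]|); rewrite normr_gt0 => /(_ q0) /=.
rewrite near_simpl -nbhs_nearE => /nbhs_ballP [e /= e0 qe].
have sg x : `|x - x0| < e -> 0 < q.[x0] * q.[x].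
  move=> xe; have /= := qe x; rewrite /ball /= distrC => /(_ xe).
  by case: (ltrgtP q.[x0] 0) q0 => //= q0 _; rewrite ?(ltr0_norm q0) ?(gtr0_norm q0)
    ltr_norml => /andP[? ?]; nra.
have [x1 [x2 [/sg s1 /sg s2 pp]]] := cr _ e0.
have := mulr_ge0 (pos x1) (pos x2); rewrite !hornerM.
have -> : q.[x1] * p.[x1] * (q.[x2] * p.[x2]) = (q.[x1] * q.[x2]) * (p.[x1] * p.[x2]) by ring.
rewrite nmulr_lge0 // leNgt => /negP; apply.
rewrite -(pmulr_rgt0 _ (_ : 0 < q.[x0] ^+ 2)) ?exprn_even_gt0 //.
have -> : q.[x0] ^+ 2 * (q.[x1] * q.[x2]) = (q.[x0] * q.[x1]) * (q.[x0] * q.[x2]) by ring.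
exact: mulr_gt0.
Qed.

Lemma horner_slice h (x y : R) : h.[x, y] = (swapXY h).[y%:P].[x].
Proof. by rewrite horner2_swapXY. Qed.

(** The factor p that vanishes on the curve through the zero is x on the y-axis, and
    the binomial elsewhere.  It crosses zero along the horizontal line through the
    zero, so the cofactor q vanishes there too, and p divides q in turn. *)
Lemma semidefinite_square_x t k h (x0 y0 : R) : (0 < t.1)%N -> (0 < t.2)%N ->
  coprime t.1 t.2 -> y0 != 0 -> quasihom t k h -> (forall x y : R, 0 <= h.[x, y]) ->
  h.[x0, y0] = 0 -> exists p q, p.[x0, y0] = 0 /\ h = q * p ^+ 2.
Proof.
move=> t1 t2 cop y00 hh pos hz.
have main p : p.[x0, y0] = 0 -> crosses_zero (fun x => p.[x, y0]) x0 ->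
    (forall k h, quasihom t k h -> h.[x0, y0] = 0 ->
      exists2 q, (exists l, quasihom t l q) & h = q * p) ->
    exists p q, p.[x0, y0] = 0 /\ h = q * p ^+ 2.
  move=> pz cr fac; have [q [l hq] hE] := fac _ _ hh hz.
  have qz : q.[x0, y0] = 0.
    rewrite horner_slice; apply: (@cofactor_vanishes (swapXY p).[y0%:P]).
      by move=> e /cr [x1 [x2 H]]; exists x1, x2; rewrite -!horner_slice.
    by move=> x; rewrite hornerM -!horner_slice -hornerM -hornerM -hE.
  have [s _ qE] := fac _ _ hq qz.
  by exists p, s; split=> //; rewrite hE qE; ring.
have [x00|x00] := eqVneq x0 0.
  rewrite x00 in hz main *; apply: (main 'X).
  - by rewrite hornerX hornerC.
  - by move=> e /crosses_zero_id [x1 [x2 H]]; exists x1, x2; rewrite !hornerX !hornerC.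
  - move=> k' h' hh' hz'; have [q hq hE] := X_factor t2 y00 hh' hz'.
    by exists q => //; exists (k' - t.1%:Z).
apply: (main (binomXY t x0 y0)).
- by rewrite horner_binomXY mulrC subrr.
- move=> e /(@crosses_zero_exprn t.2 (y0 ^+ t.1) x0 t2 (expf_neq0 _ y00) x00).
  by move=> [x1 [x2 H]]; exists x1, x2; rewrite !horner_binomXY.
- move=> k' h' hh' hz'; have [q hq hE] := binomXY_factor t1 t2 cop x00 y00 hh' hz'.
  by exists q => //; exists (k' - (t.1 * t.2)%N%:Z).
Qed.

Lemma semidefinite_square t k h (x0 y0 : R) : (0 < t.1)%N -> (0 < t.2)%N ->
  coprime t.1 t.2 -> (x0, y0) != (0, 0) -> quasihom t k h ->
  (forall x y : R, 0 <= h.[x, y]) ->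
  h.[x0, y0] = 0 -> exists p q, p.[x0, y0] = 0 /\ h = q * p ^+ 2.
Proof.
move=> t1 t2 cop z0 hh pos hz.
have [y00|y00] := eqVneq y0 0; last exact: (semidefinite_square_x t1 t2 cop y00 hh).
have x00 : x0 != 0 by apply: contra_neq z0 => ->; rewrite y00.
have [|||p [q [pz hE]]] := @semidefinite_square_x (t.2, t.1) k (swapXY h) y0 x0 t2 t1
  _ x00 (quasihom_swapXY hh).
- by rewrite coprime_sym.
- by move=> x y; rewrite horner2_swapXY.
- by rewrite horner2_swapXY.
exists (swapXY p), (swapXY q); rewrite horner2_swapXY; split=> //.
by rewrite -[h]swapXYK hE rmorphM rmorphXn.
Qed.

Lemma complexify_horner p (x y : R) :
  (complexify p).[x%:C%C, y%:C%C] = (p.[x, y])%:C%C.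
Proof. by rewrite /complexify -map_polyC !horner_map /=. Qed.

Lemma quasihom_complexify t k h : qh t k (complexify h) -> quasihom t k h.
Proof.
move=> /qh_quasihom hh i j hij; apply: hh; rewrite /complexify !coef_map /=.
by apply: contra_neq hij => /complexI.
Qed.

(** A real zero of a semidefinite form is a zero of even multiplicity along the
    whole curve through it, against the simplicity of the factors. *)
Lemma simple_factors_indefinite t k h (x0 y0 : R) : (0 < t.1)%N -> (0 < t.2)%N ->
  coprime t.1 t.2 -> quasihom t k h -> simple_factors (complexify h) ->
  (x0, y0) != (0, 0) -> h.[x0, y0] = 0 -> ~ (forall x y : R, 0 <= h.[x, y]).
Proof.
move=> t1 t2 cop hh simp z0 hz pos.
have [p [q [pz hE]]] := semidefinite_square t1 t2 cop z0 hh pos hz.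
apply: (simple_factors_square (p := complexify p) (q := complexify q)
  (x := x0%:C%C) (y := y0%:C%C) simp).
  by rewrite complexify_horner pz.
by rewrite hE /complexify !(rmorphM, rmorphXn).
Qed.

Lemma simple_factorsN (K : numFieldType) (p : {poly {poly K}}) :
  simple_factors p -> simple_factors (- p).
Proof.
move=> [p0 simp]; split; first by rewrite oppr_eq0.
move=> s irr [q hE]; apply: (simp s irr); exists (- q).
by rewrite mulrN -hE opprK.
Qed.

End Semidefinite.

(** * Blowing up a convergent double series *)

Section BlowUp.
Variable R : realType.
Implicit Types (p h : {poly {poly R}}) (t : nat * nat) (c : nat -> nat -> R).

Lemma exprn_lip (B a b : R) n : `|a| <= B -> `|b| <= B ->
  `|a ^+ n - b ^+ n| <= n%:R * B ^+ n.-1 * `|a - b|.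
Proof.
move=> aB bB; have B0 : 0 <= B by apply: le_trans aB.
elim: n => [|[|n] IH]; first by rewrite !expr0 subrr normr0 mul0r mul0r.
  by rewrite !expr1 expr0 !mul1r.
have -> : a ^+ n.+2 - b ^+ n.+2 = a * (a ^+ n.+1 - b ^+ n.+1) + (a - b) * b ^+ n.+1.
  by rewrite !exprS; ring.
apply: (le_trans (ler_normD _ _)); rewrite !normrM normrX /=.
have -> : n.+2%:R * B ^+ n.+1 * `|a - b| =
   B * (n.+1%:R * B ^+ n * `|a - b|) + `|a - b| * B ^+ n.+1.
  by rewrite -[n.+2]addn1 natrD exprS; ring.
apply: lerD; first exact: ler_pM.
by rewrite ler_wpM2l // lerXn2r // nnegrE.
Qed.

Lemma monomial_lip (B r r' x x' y y' : R) (m i j : nat) :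
  0 <= B <= 1 -> `|r| <= B -> `|r'| <= B ->
  `|x| <= 1 -> `|x'| <= 1 -> `|y| <= 1 -> `|y'| <= 1 ->
  `|r ^+ m * x ^+ i * y ^+ j - r' ^+ m * x' ^+ i * y' ^+ j| <=
  (m + i + j)%:R * B ^+ m.-1 * (`|r - r'| + `|x - x'| + `|y - y'|).
Proof.
move=> /andP[B0 B1] rB r'B x1 x1' y1 y1'.
have -> : r ^+ m * x ^+ i * y ^+ j - r' ^+ m * x' ^+ i * y' ^+ j =
  (r ^+ m - r' ^+ m) * (x ^+ i * y ^+ j) +
  (r' ^+ m * y ^+ j) * (x ^+ i - x' ^+ i) +
  (r' ^+ m * x' ^+ i) * (y ^+ j - y' ^+ j) by ring.
have pw1 (z : R) n : `|z| <= 1 -> `|z ^+ n| <= 1 by move=> z1; rewrite normrX exprn_ile1.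
have pwm : `|r' ^+ m| <= B ^+ m.-1.
  rewrite normrX; apply: (@le_trans _ _ (B ^+ m)); first by rewrite lerXn2r // nnegrE.
  by apply: ler_wiXn2l; rewrite ?B0 // leq_pred.
have Bm : 0 <= B ^+ m.-1 by rewrite exprn_ge0.
have X := exprn_lip m rB r'B; have Y := exprn_lip i x1 x1'; have Z := exprn_lip j y1 y1'.
rewrite expr1n mulr1 in Y; rewrite expr1n mulr1 in Z.
apply: (@le_trans _ _ (m%:R * B ^+ m.-1 * `|r - r'| +
   B ^+ m.-1 * (i%:R * `|x - x'|) + B ^+ m.-1 * (j%:R * `|y - y'|))).
  apply: (le_trans (ler_normD _ _)); apply: lerD.
    apply: (le_trans (ler_normD _ _)); apply: lerD.
      rewrite normrM -[leRHS]mulr1; apply: ler_pM => //.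
      by rewrite normrM mulr_ile1 // pw1.
    rewrite normrM; apply: ler_pM => //; rewrite normrM -[leRHS]mulr1.
    by apply: ler_pM => //; exact: pw1.
  rewrite normrM; apply: ler_pM => //; rewrite normrM -[leRHS]mulr1.
  by apply: ler_pM => //; exact: pw1.
have := normr_ge0 (r - r'); have := normr_ge0 (x - x'); have := normr_ge0 (y - y').
move: (`|r - r'|) (`|x - x'|) (`|y - y'|) => a b d d0 b0 a0.
have mi : 0 <= (m%:R : R) by []; have ii : 0 <= (i%:R : R) by [].
have ji : 0 <= (j%:R : R) by [].
rewrite !natrD -subr_ge0.
have -> : (m%:R + i%:R + j%:R) * B ^+ m.-1 * (a + b + d) -
  (m%:R * B ^+ m.-1 * a + B ^+ m.-1 * (i%:R * b) + B ^+ m.-1 * (j%:R * d)) =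
  B ^+ m.-1 * (m%:R * (b + d) + i%:R * (a + d) + j%:R * (a + b)) by ring.
by rewrite mulr_ge0 // !addr_ge0 // mulr_ge0 // addr_ge0.
Qed.

Lemma closed_ler_lim (u v : nat -> R) (a b : R) :
  u @ \oo --> a -> v @ \oo --> b -> (forall n, u n <= v n) -> a <= b.
Proof.
move=> ua vb uv; have cu : cvgn u by apply/cvg_ex; exists a.
have cv : cvgn v by apply/cvg_ex; exists b.
rewrite -(cvg_lim _ ua) // -(cvg_lim _ vb) //.
by apply: ler_lim => //; exact: nearW.
Qed.

(** The exponent of r, lowered by one when differentiating, still exceeds the total
    degree up to a constant. *)
Lemma weight_lower_bound (a b e w i j : nat) : (0 < a)%N -> (0 < b)%N ->
  (w <= a * i + b * j + e)%N -> (i + j <= (a * i + b * j + e - w).-1 + w.+1)%N.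
Proof. by move=> a0 b0; have := leq_pmull i a0; have := leq_pmull j b0; lia. Qed.

Lemma weight_upper_bound (a b e w i j : nat) :
  (a * i + b * j + e - w + i + j <= (a + b + e + 1) * (i + j).+1)%N.
Proof.
have h1 : (a * i <= a * (i + j))%N by rewrite leq_mul2l leq_addr orbT.
have h2 : (b * j <= b * (i + j))%N by rewrite leq_mul2l leq_addl orbT.
rewrite -addnA; move: (i + j)%N h1 h2 => n h1 h2; rewrite mulnS !mulnDl.
by have := leq_subr w (a * i + b * j + e)%N; lia.
Qed.

(** A is the field component f in weighted polar coordinates, divided by the power
    of r that it contains: r ^ e f = r ^ w A.  The shift e keeps the exponents
    natural when w - e, the weight of the leading part p of f, is negative. *)
Definition blow_up t (e w : nat) (f : R -> R -> R) p (r1 K : R) (A : R -> R -> R -> R) :=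
  [/\ 0 < r1 <= 1 /\ 0 <= K,
      forall r x y, 0 < r <= r1 -> `|x| <= 1 -> `|y| <= 1 ->
        r ^+ e * f (r ^+ t.1 * x) (r ^+ t.2 * y) = r ^+ w * A r x y,
      forall r r' x x' y y', 0 <= r <= r1 -> 0 <= r' <= r1 ->
        `|x| <= 1 -> `|x'| <= 1 -> `|y| <= 1 -> `|y'| <= 1 ->
        `|A r x y - A r' x' y'| <= K * (`|r - r'| + `|x - x'| + `|y - y'|) &
      forall x y, A 0 x y = p.[x, y]].

(** After the substitution every term c_ij x^i y^j carries the power
    t1 i + t2 j + e - w of r, which is nonnegative by assumption.  The partial sums
    of the new series are equi-Lipschitz on a small box, so the sum is Lipschitz up to
    r = 0, where only the terms of weight exactly w - e survive. *)
Lemma blow_up_exists t (e w : nat) (f : R -> R -> R) c p :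
  (0 < t.1)%N -> (0 < t.2)%N -> has_expansion f c ->
  quasihom t (w%:Z - e%:Z) p ->
  (forall i j, c i j != 0 -> (w <= t.1 * i + t.2 * j + e)%N) ->
  (forall i j, (t.1 * i + t.2 * j + e)%N = w -> c i j = p`_i`_j) ->
  exists r1 K A, blow_up t e w f p r1 K A.
Proof.
move=> t1 t2 [rho rho0 [[M cM] cf]] hp cw cp.
(* The Lipschitz constant of a term of degree n grows like n + 1; this factor is
   at most 2 ^ n, hence absorbed by halving the radius of convergence. *)
pose r1 : R := Num.min 1 (rho / 2).
have r10 : 0 < r1 by rewrite lt_min ltr01 divr_gt0.
have r11 : r1 <= 1 by rewrite ge_min lexx.
have r1rho : 2 * r1 <= rho by rewrite mulrC -ler_pdivlMr // ge_min lexx orbT.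
have M0 : 0 <= M by have := cM 0%N; rewrite big_ord0.
pose m i j := (t.1 * i + t.2 * j + e - w)%N.
pose T := (t.1 + t.2 + e + 1)%N.
pose K := T%:R * r1 ^- w.+1 * M.
pose a n r x y : R := \sum_(i < n) \sum_(j < n) c i j * (r ^+ m i j * x ^+ i * y ^+ j).
pose A r x y := if r == 0 then p.[x, y]
  else r ^+ e * f (r ^+ t.1 * x) (r ^+ t.2 * y) / r ^+ w.
have K0 : 0 <= K by rewrite !mulr_ge0 // invr_ge0 exprn_ge0 // ltW.
have pw1 (r : R) n : 0 <= r <= r1 -> (0 < n)%N -> r ^+ n <= r1.
  move=> /andP[r0 rr1] n0; apply: (le_trans _ rr1); rewrite -[leRHS]expr1.
  by apply: ler_wiXn2l => //; exact: le_trans rr1 r11.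
have aA r x y : 0 <= r <= r1 -> `|x| <= 1 -> `|y| <= 1 ->
    a n r x y @[n --> \oo] --> A r x y.
  move=> rr x1 y1; rewrite /A; case: eqVneq => [->|rn0].
    apply: cvg_near_cst; exists (maxn (size p) (sizeY p)) => // n /=; rewrite geq_max.
    move=> /andP[nX nY]; rewrite (horner2E _ _ nX nY); apply: eq_bigr => i _.
    apply: eq_bigr => j _; rewrite !mulrA expr0n; congr (_ * _ * _).
    rewrite /m subn_eq0; case: leqP => [le|lt].
      rewrite mulr1; have [c0|cn0] := eqVneq (c i j) 0; last by apply: cp; have := cw i j cn0; lia.
      rewrite c0; apply/esym/eqP/negPn/negP => pij; move: (pij).
      rewrite -cp ?c0 ?eqxx //; have := hp i j pij; lia.
    by rewrite mulr0; apply/esym/eqP/negPn/negP => /hp; lia.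
  have r0 : 0 < r by rewrite lt_neqAle eq_sym rn0; case/andP: rr.
  have small (z : R) n : (0 < n)%N -> `|z| <= 1 -> `|r ^+ n * z| < rho.
    move=> n0 z1; rewrite normrM ger0_norm ?exprn_ge0 ?ltW //.
    apply: (@le_lt_trans _ _ (r1 * 1)); last by move: r1rho r10; lra.
    by apply: ler_pM => //; [rewrite exprn_ge0 // ltW|exact: pw1].
  have -> : (fun n => a n r x y) = (fun n => r ^+ e *
      (\sum_(i < n) \sum_(j < n) c i j * (r ^+ t.1 * x) ^+ i * (r ^+ t.2 * y) ^+ j) / r ^+ w).
    apply/funext => n; rewrite mulr_sumr mulr_suml; apply: eq_bigr => i _.
    rewrite mulr_sumr mulr_suml; apply: eq_bigr => j _.
    have [->|cn0] := eqVneq (c i j) 0; first by rewrite !(mul0r, mulr0).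
    have rw : r ^+ w != 0 by rewrite expf_neq0.
    apply: (mulIf rw); rewrite divfK // !exprMn -!exprM.
    have E : r ^+ m i j * r ^+ w = r ^+ (t.1 * i) * r ^+ (t.2 * j) * r ^+ e.
      by rewrite -!exprD subnK // cw.
    have -> : c i j * (r ^+ m i j * x ^+ i * y ^+ j) * r ^+ w =
      c i j * (r ^+ m i j * r ^+ w) * x ^+ i * y ^+ j by ring.
    by rewrite E; ring.
  apply: cvgM; last exact: cvg_cst.
  by apply: cvgM; [exact: cvg_cst|apply: cf; exact: small].
have lipa n r r' x x' y y' : 0 <= r <= r1 -> 0 <= r' <= r1 ->
    `|x| <= 1 -> `|x'| <= 1 -> `|y| <= 1 -> `|y'| <= 1 ->
    `|a n r x y - a n r' x' y'| <= K * (`|r - r'| + `|x - x'| + `|y - y'|).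
  move=> /andP[r0 rr1] /andP[r'0 r'r1] x1 x1' y1 y1'.
  set d := (X in K * X); have d0 : 0 <= d by rewrite !addr_ge0.
  apply: (@le_trans _ _ (T%:R * r1 ^- w.+1 * d *
      \sum_(i < n) \sum_(j < n) `|c i j| * rho ^+ (i + j))); last first.
    rewrite [leRHS](_ : _ = T%:R * r1 ^- w.+1 * d * M); last by rewrite /K; ring.
    by rewrite ler_wpM2l // !mulr_ge0 // invr_ge0 exprn_ge0 // ltW.
  rewrite mulr_sumr -sumrB; apply: (le_trans (ler_norm_sum _ _ _)).
  apply: ler_sum => i _; rewrite mulr_sumr -sumrB; apply: (le_trans (ler_norm_sum _ _ _)).
  apply: ler_sum => j _; rewrite -mulrBr normrM.
  have [->|cn0] := eqVneq (c i j) 0; first by rewrite normr0 !mul0r mulr0.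
  rewrite mulrCA ler_wpM2l //.
  have r1b : 0 <= r1 <= 1 by rewrite (ltW r10).
  have nr : `|r| <= r1 by rewrite ger0_norm.
  have nr' : `|r'| <= r1 by rewrite ger0_norm.
  apply: (le_trans (monomial_lip (m i j) i j r1b nr nr' x1 x1' y1 y1')).
  rewrite -/d [leRHS]mulrAC ler_wpM2r //.
  rewrite -mulrA [_ * rho ^+ _]mulrC mulrA ler_pdivlMr ?exprn_gt0 //.
  have mw : (i + j <= (m i j).-1 + w.+1)%N.
    exact: weight_lower_bound t1 t2 (cw i j cn0).
  have mT : (m i j + i + j <= T * (i + j).+1)%N.
    exact: weight_upper_bound.
  apply: (@le_trans _ _ ((T * (i + j).+1)%:R * r1 ^+ (i + j))).
    rewrite -mulrA -exprD; apply: ler_pM => //; first by rewrite exprn_ge0 // ltW.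
      by rewrite ler_nat.
    by apply: ler_wiXn2l => //; rewrite ltW.
  rewrite natrM -mulrA ler_wpM2l //.
  apply: (@le_trans _ _ ((2 * r1) ^+ (i + j))); last first.
    by rewrite lerXn2r // nnegrE ?mulr_ge0 // ltW.
  rewrite exprMn; apply: ler_wpM2r; first by rewrite exprn_ge0 // ltW.
  by rewrite -natrX ler_nat ltn_expl.
exists r1, K, A; split => //.
- by rewrite r10.
- move=> r x y /andP[r0 rr1] x1 y1; rewrite /A gt_eqF // [RHS]mulrC divfK //.
  by rewrite expf_neq0 // gt_eqF.
- move=> r r' x x' y y' rr rr' x1 x1' y1 y1'.
  apply: (@closed_ler_lim _ (fun=> K * (`|r - r'| + `|x - x'| + `|y - y'|)));
    last by move=> n; exact: (lipa n).
    by apply: cvg_norm; apply: cvgB; exact: aA.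
  exact: cvg_cst.
- by move=> x y; rewrite /A eqxx.
Qed.

End BlowUp.

(** * Scalar differential equations *)

Section ScalarODE.
Variable R : realType.
Implicit Types (f g u v : R -> R).

Lemma lipschitz_continuous f (C : R) :
  (forall s s', `|f s - f s'| <= C * `|s - s'|) -> continuous f.
Proof.
move=> lip s; apply/cvgrPdist_lt => e e0; near=> s'.
apply: (le_lt_trans (lip _ _)).
apply: (@le_lt_trans _ _ ((`|C| + 1) * `|s - s'|)).
  by rewrite ler_wpM2r // (le_trans (ler_norm C)) // lerDl.
have C1 : 0 < `|C| + 1 by rewrite ltr_wpDl.
rewrite mulrC -ltr_pdivlMr //; near: s'.
by apply/nbhs_ballP; exists (e / (`|C| + 1)); [rewrite /= divr_gt0|].
Unshelve. all: by end_near. Qed.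

Lemma is_derive_continuous f (s df : R) : is_derive s 1 f df -> {for s, continuous f}.
Proof. by move=> [d _]; exact/differentiable_continuous/derivable1_diffP. Qed.

Lemma is_derive_pt f f' (s a b : R) : is_derive s 1 f a -> f =1 f' -> a = b ->
  is_derive s 1 f' b.
Proof. by move=> h /funext <- <-. Qed.

Lemma antiderivative f : continuous f ->
  exists F : R -> R, forall s : R, -1 < s -> is_derive s 1 F (f s).
Proof.
move=> cf; exists (fun x => \int[@lebesgue_measure R]_(t in `[-1, x]) f t)%R.
move=> s s1; have [|| d <-] := @continuous_FTC1_closed R f (-1) s (s + 1) _ _ s1 (cf s).
- by rewrite ltrDl.
- apply: continuous_compact_integrable; first exact: segment_compact.
  exact: continuous_subspaceT.
- by rewrite derive1E; exact: derivableP.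
Qed.

Lemma derivative_comparison u v (du dv : R -> R) (a b : R) : a <= b ->
  {within `[a, b], continuous u} -> {within `[a, b], continuous v} ->
  (forall s, a < s < b -> is_derive s 1 u (du s)) ->
  (forall s, a < s < b -> is_derive s 1 v (dv s)) ->
  (forall s, a < s < b -> `|du s| <= dv s) -> `|u b - u a| <= v b - v a.
Proof.
move=> ab cu cv Du Dv le; move: ab; rewrite le_eqVlt => /predU1P[->|ab].
  by rewrite !subrr normr0.
have in_ab s : s \in `]a, b[ -> a < s < b by rewrite in_itv.
have D1 s : s \in `]a, b[ -> is_derive s 1 (v - u) (dv s - du s).
  by move=> /in_ab sab; apply: is_deriveB; [exact: Dv|exact: Du].
have D2 s : s \in `]a, b[ -> is_derive s 1 (v + u) (dv s + du s).
  by move=> /in_ab sab; apply: is_deriveD; [exact: Dv|exact: Du].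
have C1 : {within `[a, b], continuous (v - u)}.
  by move=> x; apply: continuousD _; [exact: cv|exact/continuousN/cu].
have C2 : {within `[a, b], continuous (v + u)}.
  by move=> x; apply: continuousD _; [exact: cv|exact: cu].
have [s1 /in_ab /le + e1] := MVT ab D1 C1; have [s2 /in_ab /le + e2] := MVT ab D2 C2.
rewrite !ler_norml => /andP[l1 l2] /andP[l3 l4].
have p1 : 0 <= (dv s1 - du s1) * (b - a) by rewrite mulr_ge0 ?subr_ge0 // ltW.
have p2 : 0 <= (dv s2 + du s2) * (b - a) by apply: mulr_ge0; [lra|rewrite subr_ge0 ltW].
move: e1 e2 p1 p2; rewrite !fctE /= => <- <- p1 p2.
by apply/andP; split; lra.
Qed.

(** The limit is the supremum of u n - 2 D / 2 ^ n, a nondecreasing sequence which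
    stays below the nonincreasing u n + 2 D / 2 ^ n. *)
Lemma geometric_limit (u : nat -> R) (D : R) :
  (forall n, `|u n.+1 - u n| <= D * 2 ^- n) ->
  exists l, forall n, `|l - u n| <= 2 * D * 2 ^- n.
Proof.
move=> uD; pose q n : R := 2 ^- n.
have qS n : q n = 2 * q n.+1 by rewrite /q exprS invfM mulrA divff // mul1r.
have q0 n : 0 < q n by rewrite invr_gt0 exprn_gt0.
have D0 : 0 <= D.
  by have := uD 0%N; rewrite expr0 invr1 mulr1; apply: le_trans.
pose a n := u n - 2 * D * q n; pose b n := u n + 2 * D * q n.
have aS n : a n <= a n.+1.
  have := uD n; rewrite -/(q n) ler_norml /a qS => /andP[h _].
  rewrite -subr_ge0; have -> : u n.+1 - 2 * D * q n.+1 - (u n - 2 * D * (2 * q n.+1)) =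
   (u n.+1 - u n) + D * (2 * q n.+1) by ring.
  by lra.
have bS n : b n.+1 <= b n.
  have := uD n; rewrite -/(q n) ler_norml /b qS => /andP[_ h].
  rewrite -subr_ge0; have -> : u n + 2 * D * (2 * q n.+1) - (u n.+1 + 2 * D * q n.+1) =
   D * (2 * q n.+1) - (u n.+1 - u n) by ring.
  by lra.
have am m n : (m <= n)%N -> a m <= a n.
  elim: n => [|n IH]; first by rewrite leqn0 => /eqP ->.
  by rewrite leq_eqVlt => /predU1P[->//|/IH h]; apply: (le_trans h).
have bm m n : (m <= n)%N -> b n <= b m.
  elim: n => [|n IH]; first by rewrite leqn0 => /eqP ->.
  by rewrite leq_eqVlt => /predU1P[->//|/IH]; apply: le_trans.
have ab m n : a m <= b n.
  apply: (le_trans (am m (maxn m n) (leq_maxl _ _))).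
  apply: (le_trans _ (bm n (maxn m n) (leq_maxr _ _))).
  rewrite /a /b; have := mulr_ge0 (mulr_ge0 (ler0n _ 2) D0) (ltW (q0 (maxn m n))).
  by move=> h; lra.
have hs : has_sup (range a).
  by split; [exists (a 0%N), 0%N|exists (b 0%N) => _ [m _ <-]].
exists (sup (range a)) => n.
have l1 : a n <= sup (range a) by apply: sup_upper_bound => //; exists n.
have l2 : sup (range a) <= b n.
  by apply: ge_sup; [case: hs|move=> _ [m _ <-]].
by rewrite ler_norml -/(q n); move: l1 l2; rewrite /a /b => l1 l2; apply/andP; split; lra.
Qed.


Lemma max0_lip (s s' : R) : `|Num.max 0 s - Num.max 0 s'| <= `|s - s'|.
Proof.
wlog ss : s s' / s <= s' => [W|].
  by have [/W //|/ltW/W] := leP s s'; rewrite distrC [leRHS]distrC.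
rewrite distrC [leRHS]distrC [leRHS]ger0_norm ?subr_ge0 //.
rewrite ger0_norm; last by rewrite subr_ge0 ge_max !le_max lexx ss orbT.
by rewrite /Num.max; case: ltP => h1; case: ltP => h2; lra.
Qed.

Lemma le_geometric (a b c : R) : (forall n, a <= b + c * 2 ^- n) -> a <= b.
Proof.
move=> le; rewrite leNgt; apply/negP => ba.
have d0 : 0 < a - b by rewrite subr_gt0.
have c0 : 0 <= `|c| / (a - b) by rewrite divr_ge0 // ltW.
have := archi_boundP c0; set n := Num.bound _; rewrite ltr_pdivrMr // => cn.
have n2 : (n%:R : R) <= 2 ^+ n by rewrite -natrX ler_nat ltnW // ltn_expl.
have p0 : 0 < (2 : R) ^+ n by rewrite exprn_gt0.
have := le n; rewrite -lerBlDl ler_pdivlMr // => h.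
have : (a - b) * 2 ^+ n < 2 ^+ n * (a - b).
  apply: (le_lt_trans h); apply: (le_lt_trans (ler_norm c)); apply: (lt_le_trans cn).
  by rewrite ler_pM2r.
by rewrite mulrC ltxx.
Qed.

Lemma is_derive_expM (a b s : R) :
  is_derive s 1 (fun x => a * expR (b * x)) (a * b * expR (b * s)).
Proof.
have h : is_derive s 1 (fun x => b * x : R) b by apply: is_derive_eq; exact: mulr1.
have h2 := @is_derive1_comp R (@expR R) (fun x => b * x) s _ _ (is_derive_expR _) h.
apply: (is_derive_pt (is_deriveZ a h2)) => //=.
by rewrite /GRing.scale /=; ring.
Qed.

Lemma near_ge0 (s : R) : 0 < s -> \forall s' \near s, 0 <= s'.
Proof.
move=> s0; apply/nbhs_ballP; exists s => //= s'.
by rewrite /ball /= ltr_norml => /andP[_ h]; lra.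
Qed.

(** Picard iteration.  Weighting the distance of two iterates by exp (2 L s)
    makes the integral operator a contraction of factor 1/2 on the whole
    half-line, so that no gluing of short-time solutions is needed. *)
Lemma picard (G : R -> R -> R) (L C u0 : R) : 0 < L ->
  (forall a s, `|G a s| <= C) ->
  (forall a b s, `|G a s - G b s| <= L * `|a - b|) ->
  (forall y : R -> R, continuous y -> continuous (fun s => G (y s) s)) ->
  exists y : R -> R, [/\ y 0 = u0, forall s s', `|y s - y s'| <= C * `|s - s'| &
    forall s : R, 0 < s -> is_derive s 1 y (G (y s) s)].
Proof.
move=> L0 GC GL Gcont; have C0 : 0 <= C by apply: le_trans (GC 0 0).
(* Iterates are frozen at negative arguments, which makes them continuous functions
   on the whole line, as the next antiderivative requires. *)
pose solves y z := [/\ z 0 = u0, forall s, z s = z (Num.max 0 s),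
  forall s s', `|z s - z s'| <= C * `|s - s'| &
  forall s : R, 0 < s -> is_derive s 1 z (G (y s) s)].
have step y : exists z, continuous y -> solves y z.
  have [cy|ncy] := pselect (continuous y); last by exists y => /ncy.
  have [F DF] := antiderivative (Gcont y cy).
  exists (fun s => F (Num.max 0 s) - F 0 + u0) => _; split.
  - by rewrite maxxx subrr add0r.
  - by move=> s; rewrite maxA maxxx.
  - have lipF a b : 0 <= a -> a <= b -> `|F b - F a| <= C * (b - a).
      move=> a0 ab; have DF' s : a < s < b -> is_derive s 1 F (G (y s) s).
        by move=> /andP[as_ _]; apply: DF; lra.
      have -> : C * (b - a) = C * b - C * a by ring.
      apply: (@derivative_comparison F ( *%R C) _ (fun=> C) a b ab _ _ DF') => //.
      + apply: derivable_within_continuous => s; rewrite in_itv /= => /andP[as_ _].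
        by have [] := DF s; first lra.
      + apply: continuous_subspaceT => s; exact: mulrl_continuous.
      + move=> s _; apply: is_derive_eq; exact: mulr1.
    have lipF' a b : 0 <= a -> 0 <= b -> `|F b - F a| <= C * `|b - a|.
      move=> a0 b0; have [ab|/ltW ba] := leP a b.
        by rewrite [`|b - a|]ger0_norm ?subr_ge0 // lipF.
      by rewrite distrC [`|b - a|]distrC [`|a - b|]ger0_norm ?subr_ge0 // lipF.
    move=> s s'.
    have -> : F (Num.max 0 s) - F 0 + u0 - (F (Num.max 0 s') - F 0 + u0) =
      F (Num.max 0 s) - F (Num.max 0 s') by ring.
    apply: (le_trans (lipF' _ _ _ _)); rewrite ?le_max ?lexx // ler_wpM2l //.
    exact: max0_lip.
  - move=> s s0; apply: (@near_eq_is_derive _ _ _ (fun s => F s + (- F 0 + u0))).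
      near=> s'; rewrite (_ : Num.max 0 s' = s') ?addrA //.
      by apply/max_idPr; near: s'; exact: near_ge0.
    have DFs : is_derive s 1 F (G (y s) s) by apply: DF; lra.
    apply: (is_derive_pt (is_deriveD DFs (is_derive_cst (- F 0 + u0) s 1))) => //.
    by rewrite addr0.
have [T HT] := choice step.
pose y n := iter n T (fun=> u0).
have yc n : continuous (y n).
  elim: n => [|n IH]; first by move=> s; exact: cst_continuous.
  by case: (HT _ IH) => _ _ + _ => /lipschitz_continuous.
have yS n : solves (y n) (y n.+1) by exact: HT.
pose K := C / (2 * L); pose E s := expR (2 * L * s).
have K0 : 0 <= K by rewrite divr_ge0 // mulr_ge0 // ltW.
have contr n s : 0 <= s -> `|y n.+1 s - y n s| <= K * E s * 2 ^- n.
  elim: n s => [|n IH] s s0.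
    have [z0 _ lip _] := yS 0%N; rewrite expr0 invr1 mulr1.
    have -> : y 0%N s = y 1%N 0 by rewrite z0.
    apply: (le_trans (lip _ _)); rewrite subr0 ger0_norm // /K.
    have h : 2 * L * s <= E s by apply: le_trans (expR_ge1Dx _); rewrite lerDr.
    have -> : C * s = C / (2 * L) * (2 * L * s) by field; rewrite gt_eqF.
    by rewrite ler_wpM2l.
  have [z0 _ lip D] := yS n; have [z0' _ lip' D'] := yS n.+1.
  have Dv (x : R) : is_derive x 1 (fun x => K * 2 ^- n.+1 * expR (2 * L * x))
     (L * (K * E x * 2 ^- n)).
    apply: is_derive_pt (is_derive_expM _ _ _) _ _ => //.
    rewrite /E exprS invfM; have : (2 : R) ^+ n != 0 by rewrite expf_neq0.
    by move=> p0; field.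
  have := @derivative_comparison (y n.+2 - y n.+1) _
     (fun x => G (y n.+1 x) x - G (y n x) x) _ 0 s s0 _ _ _ (fun x _ => Dv x) _.
  rewrite !fctE z0 z0' subrr subr0 => /(_ _ _ _ _)/le_trans; apply.
  - by apply: continuous_subspaceT => x; apply: continuousB; exact: yc.
  - by apply: continuous_subspaceT => x; exact: is_derive_continuous (Dv x).
  - by move=> x /andP[x0 _]; apply: is_deriveB; [exact: D'|exact: D].
  - move=> x /andP[x0 _]; apply: (le_trans (GL _ _ _)).
    by apply: ler_wpM2l; [exact: ltW|apply: IH; exact: ltW].
  - by rewrite lerBlDr mulrAC lerDl mulr_ge0 ?expR_ge0 // divr_ge0 // exprn_ge0.
have clamp n s : y n s = y n (Num.max 0 s) by case: n => [//|n]; case: (yS n).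
have contr' n s : `|y n.+1 s - y n s| <= K * E (Num.max 0 s) * 2 ^- n.
  by rewrite clamp (clamp n); apply: contr; rewrite le_max lexx.
have [yl Hyl] := choice (fun s => geometric_limit (fun n => contr' n s)).
have ylip s s' : `|yl s - yl s'| <= C * `|s - s'|.
  apply: (@le_geometric _ _ (2 * (K * E (Num.max 0 s)) + 2 * (K * E (Num.max 0 s')))) => n.
  have := Hyl s n; have := Hyl s' n.
  have : `|y n s - y n s'| <= C * `|s - s'|.
    by case: n => [|n]; [rewrite subrr normr0 mulr_ge0|case: (yS n)].
  have -> : yl s - yl s' = (yl s - y n s) + (y n s - y n s') + (y n s' - yl s') by ring.
  move=> h1 h2 h3; apply: (le_trans (ler_normD _ _)); rewrite [`|y n s' - _|]distrC.
  have := ler_normD (yl s - y n s) (y n s - y n s').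
  by move: h1 h2 h3; rewrite mulrDl; lra.
have ylc := lipschitz_continuous ylip.
have [z0 zcl zlip zD] := HT yl ylc.
have zE s : 0 <= s -> T yl s = yl s.
  move=> s0; apply/eqP; rewrite -subr_eq0 -normr_le0.
  have Es : Num.max 0 s = s by apply/max_idPr.
  apply: (@le_geometric _ _ (K * E s + 2 * (K * E s))) => n; rewrite add0r.
  have [y0 _ _ D] := yS n.
  have Dv (x : R) : is_derive x 1 (fun x => K * 2 ^- n * expR (2 * L * x))
     (L * (2 * (K * E x) * 2 ^- n)).
    by apply: is_derive_pt (is_derive_expM _ _ _) _ _ => //; rewrite /E; ring.
  have h1 : `|T yl s - y n.+1 s| <= K * E s * 2 ^- n.
    have := @derivative_comparison (T yl - y n.+1) _
       (fun x => G (yl x) x - G (y n x) x) _ 0 s s0 _ _ _ (fun x _ => Dv x) _.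
    rewrite !fctE z0 y0 subrr subr0 => /(_ _ _ _ _)/le_trans; apply.
    - apply: continuous_subspaceT => x; apply: continuousB.
        exact: lipschitz_continuous zlip _.
      exact: yc.
    - by apply: continuous_subspaceT => x; exact: is_derive_continuous (Dv x).
    - by move=> x /andP[x0 _]; apply: is_deriveB; [exact: zD|exact: D].
    - move=> x /andP[x0 _]; apply: (le_trans (GL _ _ _)).
      apply: ler_wpM2l; first exact: ltW.
      by have := Hyl x n; rewrite (_ : Num.max 0 x = x) //; apply/max_idPr; exact: ltW.
    - by rewrite lerBlDr mulrAC lerDl mulr_ge0 ?expR_ge0 // divr_ge0 // exprn_ge0.
  have := Hyl s n.+1; rewrite Es => h2.
  have q0 : 0 <= (2 : R) ^- n by rewrite invr_ge0 exprn_ge0.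
  have h3 : 2 * (K * E s) * 2 ^- n.+1 <= 2 * (K * E s) * 2 ^- n.
    have E0 : 0 <= E s by exact: expR_ge0.
    rewrite exprS invfM; apply: ler_wpM2l.
      by rewrite mulr_ge0 // mulr_ge0.
    by move: q0; move: (2 ^- n) => q q0; lra.
  have -> : T yl s - yl s = (T yl s - y n.+1 s) - (yl s - y n.+1 s) by ring.
  apply: (le_trans (ler_normB _ _)); rewrite mulrDl; apply: lerD => //.
  exact: le_trans h3.
exists yl; split => //; first by rewrite -zE.
move=> s s0; apply: (@near_eq_is_derive _ _ _ (T yl)); last exact: zD.
near=> s'; apply: zE; near: s'; exact: near_ge0.
Unshelve. all: by end_near. Qed.

End ScalarODE.

(** * Weighted polar coordinates *)

Section WeightedPolar.
Variable R : realType.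
Implicit Types (f g : R -> R -> R).

Lemma unit_angle (c s : R) : c ^+ 2 + s ^+ 2 = 1 ->
  exists2 phi, - pi <= phi <= pi & c = cos phi /\ s = sin phi.
Proof.
move=> cs; have c1 : -1 <= c <= 1.
  by rewrite -ler_norml -(@ler_pXn2r _ 2) ?nnegrE // expr1n -normrX ger0_norm ?sqr_ge0 //;
    have := sqr_ge0 s; lra.
have a0 := acos_ge0 c1; have api := acos_lepi c1.
have ca : cos (acos c) = c by rewrite acosK // in_itv.
have sa : sin (acos c) = `|s|.
  rewrite sin_acos // (_ : 1 - c ^+ 2 = s ^+ 2) ?sqrtr_sqr //; lra.
have [s0|s0] := leP 0 s.
  by exists (acos c); [apply/andP; split; have := pi_ge0 R; lra|rewrite ca sa ger0_norm].
exists (- acos c); first by apply/andP; split; have := pi_ge0 R; lra.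
by rewrite cosN sinN ca sa ltr0_norm // opprK.
Qed.

(** The weighted radius r of (a, b) is the positive root of
    a^2 r^(2 t2) + b^2 r^(2 t1) = r^(2 t1 + 2 t2), found between a small multiple of
    |a| or |b| and e. *)
Lemma weighted_polar (t1 t2 : nat) (e : R) : (0 < t1)%N -> (0 < t2)%N -> 0 < e ->
  exists2 d : R, 0 < d & forall a b, 0 < a ^+ 2 + b ^+ 2 < d ^+ 2 ->
    exists r phi, [/\ 0 < r < e, a = r ^+ t1 * cos phi & b = r ^+ t2 * sin phi].
Proof.
move=> t10 t20; wlog e1 : e / e < 1 => [W e0|e0].
  have [||d d0 H] := W (Num.min e (1 / 2)); first by rewrite gt_min; apply/orP; right; lra.
    by rewrite lt_min e0 /=; lra.
  exists d => // a b /H [r [phi [/andP[r0]]]]; rewrite lt_min => /andP[re _] aE bE.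
  by exists r, phi; rewrite r0.
exists (e ^+ (t1 + t2)) => [|a b /andP[ab0 abd]]; first by rewrite exprn_gt0.
pose P (r : R) := a ^+ 2 * r ^+ (t2 * 2) + b ^+ 2 * r ^+ (t1 * 2) - r ^+ ((t1 + t2) * 2).
have Pc : continuous P.
  move=> r; rewrite /P; apply: cvgB; last exact: exprn_continuous.
  by apply: cvgD; apply: cvgM; (exact: cvg_cst || exact: exprn_continuous).
have a20 := sqr_ge0 a; have b20 := sqr_ge0 b.
have Pe : P e <= 0.
  have h1 : e ^+ (t2 * 2) <= 1 by rewrite exprn_ile1 // ltW.
  have h2 : e ^+ (t1 * 2) <= 1 by rewrite exprn_ile1 // ltW.
  rewrite /P subr_le0 [e ^+ ((t1 + t2) * 2)]exprM; apply: (le_trans _ (ltW abd)).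
  by apply: lerD; rewrite -[leRHS]mulr1 ler_wpM2l.
have ed : e ^+ ((t1 + t2) * 2) <= e ^+ 2.
  by apply: ler_wiXn2l; [exact: ltW|exact: ltW|rewrite leq_pmull // addn_gt0 t10].
have pos (c r : R) (u v : nat) : (0 < u)%N -> 0 < r -> r < 1 -> r < `|c| ->
    r ^+ ((u + v) * 2) < c ^+ 2 * r ^+ (v * 2).
  move=> u0 r0 r1 rc; rewrite mulnDl exprD ltr_pM2r ?exprn_gt0 //.
  apply: (@le_lt_trans _ _ (r ^+ 2)).
    by apply: ler_wiXn2l; [exact: ltW|exact: ltW|rewrite leq_pmull].
  by rewrite -[c ^+ 2]real_normK ?num_real // ltrXn2r // ltW.
have nlt (c : R) : c ^+ 2 <= a ^+ 2 + b ^+ 2 -> `|c| < e.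
  move=> cab; rewrite -(@ltr_pXn2r _ 2) ?nnegrE ?(ltW e0) // real_normK ?num_real //.
  by apply: (le_lt_trans cab); apply: (lt_le_trans abd); rewrite -exprM.
have [r0 [r00 r0e Pr0]] : exists r0, [/\ 0 < r0, r0 < e & 0 <= P r0].
  have [a0|a0] := eqVneq a 0.
    have b0 : b != 0 by apply: contraTneq ab0 => ->; rewrite a0 !expr0n /= addr0 ltxx.
    have nb : 0 < `|b| by rewrite normr_gt0.
    have be : `|b| < e by apply: nlt; rewrite lerDr.
    exists (`|b| / 2); split; [lra|lra|].
    rewrite /P a0 expr0n mul0r add0r subr_ge0 ltW // [(t1 + t2)%N]addnC.
    by apply: pos => //; lra.
  have na : 0 < `|a| by rewrite normr_gt0.
  have ae : `|a| < e by apply: nlt; rewrite lerDl.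
  exists (`|a| / 2); split; [lra|lra|].
  have h : (`|a| / 2) ^+ ((t1 + t2) * 2) < a ^+ 2 * (`|a| / 2) ^+ (t2 * 2).
    by apply: pos => //; lra.
  have h' : 0 <= b ^+ 2 * (`|a| / 2) ^+ (t1 * 2).
    by rewrite mulr_ge0 // exprn_ge0 // divr_ge0.
  by rewrite /P; lra.
have [|r] := @IVT R P r0 e 0 (ltW r0e) (continuous_subspaceT Pc).
  by rewrite ge_min le_max Pe Pr0 orbT.
rewrite in_itv /= => /andP[r0r re] Pr.
have rp : 0 < r by exact: lt_le_trans r0r.
have rt1 : r ^+ t1 != 0 by rewrite expf_neq0 // gt_eqF.
have rt2 : r ^+ t2 != 0 by rewrite expf_neq0 // gt_eqF.
have [|phi _ [cE sE]] := @unit_angle (a / r ^+ t1) (b / r ^+ t2).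
  move: Pr; rewrite /P !exprM exprD => /eqP; rewrite subr_eq0 => /eqP H.
  rewrite !expr_div_n; have -> : a ^+ 2 / (r ^+ t1) ^+ 2 + b ^+ 2 / (r ^+ t2) ^+ 2 =
    (a ^+ 2 * (r ^+ t2) ^+ 2 + b ^+ 2 * (r ^+ t1) ^+ 2) / (r ^+ t1 * r ^+ t2) ^+ 2.
    by field; rewrite rt1 rt2.
  by rewrite H divff // expf_neq0 // mulf_neq0.
exists r, phi; rewrite -cE -sE; split.
- rewrite rp lt_neqAle re andbT; apply/eqP => rE.
  have : P e < 0.
    have h1 : e ^+ (t2 * 2) <= 1 by rewrite exprn_ile1 // ltW.
    have h2 : e ^+ (t1 * 2) <= 1 by rewrite exprn_ile1 // ltW.
    rewrite /P subr_lt0 [e ^+ ((t1 + t2) * 2)]exprM; apply: (le_lt_trans _ abd).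
    by apply: lerD; rewrite -[leRHS]mulr1 ler_wpM2l.
  by rewrite -rE Pr ltxx.
- by rewrite mulrC divfK.
- by rewrite mulrC divfK.
Qed.

Lemma inverse_function (F k : R -> R) (L : R) : 0 < L -> (forall s, 0 < k s) ->
  (forall s : R, -1 < s -> is_derive s 1 F (k s)) ->
  F 0 < F L /\ exists psi : R -> R, [/\ psi (F 0) = 0, psi (F L) = L,
    forall t, F 0 <= t <= F L -> 0 <= psi t <= L,
    {within `[F 0, F L], continuous psi} &
    forall t : R, F 0 < t < F L ->
      0 < psi t < L /\ is_derive t 1 psi (k (psi t))^-1].
Proof.
move=> L0 k0 DF.
have cF a b : 0 <= a -> {within `[a, b], continuous F}.
  move=> a0; apply: derivable_within_continuous => s; rewrite in_itv /= => /andP[as_ _].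
  by have [] := DF s; first lra.
have inc a b : 0 <= a -> a < b -> F a < F b.
  move=> a0 ab; have [|c _ e] := MVT ab _ (cF a b a0) (df := k).
    by move=> s; rewrite in_itv /= => /andP[as_ _]; apply: DF; lra.
  by rewrite -subr_gt0 e mulr_gt0 // subr_gt0.
have inj a b : 0 <= a -> 0 <= b -> F a = F b -> a = b.
  move=> a0 b0 e; have [ab|ba|//] := ltgtP a b.
    by have := inc a b a0 ab; rewrite e ltxx.
  by have := inc b a b0 ba; rewrite e ltxx.
have FL := inc 0 L (lexx 0) L0; split => //.
have ex t : exists s, F 0 <= t <= F L -> 0 <= s <= L /\ F s = t.
  have [tF|ntF] := boolP (F 0 <= t <= F L); last by exists 0.
  have [|s] := @IVT R F 0 L t (ltW L0) (cF 0 L (lexx 0)).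
    by rewrite (min_idPl (ltW FL)) (max_idPr (ltW FL)).
  by rewrite in_itv /= => sL e; exists s.
have [psi Hpsi] := choice ex.
have mono a b : 0 <= a -> a <= b -> F a <= F b.
  by move=> a0; rewrite le_eqVlt => /predU1P[->//|/(inc _ _ a0)/ltW].
have can s : 0 <= s <= L -> psi (F s) = s.
  move=> /andP[s0 sL]; have [|/andP[p0 pL] e] := Hpsi (F s); last exact: inj.
  by rewrite !mono.
exists psi; split.
- by rewrite can // lexx ltW.
- by rewrite can // lexx ltW.
- by move=> t /Hpsi [].
- apply: (@segment_can_le_continuous _ 0 L F) => //; first exact: ltW.
  exact: cF.
move=> t /[dup] tF /andP[tF0 tFL].
have [|/andP[p0 pL] e] := Hpsi t; first by rewrite !ltW.
have p0' : 0 < psi t.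
  by rewrite lt_neqAle p0 andbT; apply/eqP => h; move: tF0; rewrite -e -h ltxx.
have pL' : psi t < L.
  by rewrite lt_neqAle pL andbT; apply/eqP => pE; move: tFL; rewrite -e pE ltxx.
have nr : \forall s \near psi t, 0 < s < L.
  have pin : psi t \in `]0, L[ by rewrite in_itv /= p0' pL'.
  by have := near_in_itvoo pin; apply: filterS => s /=; rewrite in_itv.
have D : is_derive (F (psi t)) 1 psi (k (psi t))^-1.
  apply: is_derive_inverse.
  - by apply: filterS nr => s /andP[s0 sL]; apply: can; rewrite !ltW.
  - apply: filterS nr => s /andP[s0 sL]; apply: (@is_derive_continuous _ _ _ (k s)).
    by apply: DF; lra.
  - by apply: DF; lra.
  - by rewrite gt_eqF.
by rewrite e in D; rewrite p0' pL'.
Unshelve. all: by end_near. Qed.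

End WeightedPolar.

(** * The polar angle along an orbit *)

Section Turning.
Variable R : realType.
Implicit Types (f g : R -> R -> R).

Lemma solution_on_le f g (T T' : R) (x y : R -> R) : T' <= T ->
  solution_on f g T x y -> solution_on f g T' x y.
Proof.
move=> TT [cx cy D]; split.
- by apply: continuous_subspaceW cx; apply: subset_itvl; rewrite bnd_simp.
- by apply: continuous_subspaceW cy; apply: subset_itvl; rewrite bnd_simp.
- by move=> s /andP[s0 sT]; apply: D; rewrite s0 (lt_le_trans sT).
Qed.

Lemma within_continuousM (A : set R) (u v : R -> R) : {within A, continuous u} ->
  {within A, continuous v} -> {within A, continuous (fun s => u s * v s)}.
Proof. by move=> cu cv z; apply: cvgM; [exact: cu|exact: cv]. Qed.

Lemma within_continuousD (A : set R) (u v : R -> R) : {within A, continuous u} ->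
  {within A, continuous v} -> {within A, continuous (fun s => u s + v s)}.
Proof. by move=> cu cv z; apply: cvgD; [exact: cu|exact: cv]. Qed.

Lemma within_continuousB (A : set R) (u v : R -> R) : {within A, continuous u} ->
  {within A, continuous v} -> {within A, continuous (fun s => u s - v s)}.
Proof. by move=> cu cv z; apply: cvgB; [exact: cu|exact: cv]. Qed.

Lemma continuous_within_comp (A : set R) (u v : R -> R) : continuous u ->
  {within A, continuous v} -> {within A, continuous (fun s => u (v s))}.
Proof. by move=> cu cv z; apply: continuous_comp; [exact: cv|exact: cu]. Qed.

Lemma within_continuousV (A : set R) (u : R -> R) : {within A, continuous u} ->
  (forall s, A s -> u s != 0) -> {within A, continuous (fun s => (u s)^-1)}.
Proof.
move=> cu u0; rewrite continuous_subspace_in => z zA; apply: cvgV; last exact: cu.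
by apply: u0; rewrite inE in zA.
Qed.

(** The polar angle of (p cos phi, q sin phi) stays within a quarter turn of phi,
    because both vectors lie in the same quadrant. *)
Lemma weighted_angle_correction (p q phi : R) : 0 < p -> 0 < q ->
  let x := p * cos phi in let y := q * sin phi in
  let d := atan ((y * cos phi - x * sin phi) / (x * cos phi + y * sin phi)) in
  [/\ 0 < x * cos phi + y * sin phi, 0 < x ^+ 2 + y ^+ 2,
      x = Num.sqrt (x ^+ 2 + y ^+ 2) * cos (phi + d) &
      y = Num.sqrt (x ^+ 2 + y ^+ 2) * sin (phi + d)].
Proof.
move=> p0 q0 x y; pose c := cos phi; pose s := sin phi.
have cs : c ^+ 2 + s ^+ 2 = 1 by exact: cos2Dsin2.
pose u := x * c + y * s; pose v := y * c - x * s.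
have u0 : 0 < u.
  have -> : u = p * c ^+ 2 + q * s ^+ 2 by rewrite /u /x /y -/c -/s; ring.
  have [c0|c0] := eqVneq c 0.
    by move: cs; rewrite c0 !expr0n /= mulr0 !add0r => ->; rewrite mulr1.
  apply: ltr_wpDr; first by rewrite mulr_ge0 ?sqr_ge0 // ltW.
  by rewrite mulr_gt0 // exprn_even_gt0.
have uv : u ^+ 2 + v ^+ 2 = x ^+ 2 + y ^+ 2.
  have -> : u ^+ 2 + v ^+ 2 = (x ^+ 2 + y ^+ 2) * (c ^+ 2 + s ^+ 2) by rewrite /u /v; ring.
  by rewrite cs mulr1.
have r20 : 0 < x ^+ 2 + y ^+ 2 by rewrite -uv ltr_wpDr ?sqr_ge0 // exprn_gt0.
pose r := Num.sqrt (x ^+ 2 + y ^+ 2).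
have r0 : 0 < r by rewrite sqrtr_gt0.
have r2 : r ^+ 2 = x ^+ 2 + y ^+ 2 by rewrite sqr_sqrtr // ltW.
have E : 1 + (v / u) ^+ 2 = (r / u) ^+ 2.
  by rewrite !expr_div_n r2 -uv mulrDl divff // expf_neq0 // gt_eqF.
move=> d; have cd : cos d = u / r.
  by rewrite /d cos_atan -/u -/v E sqrtr_sqr ger0_norm ?invf_div // divr_ge0 // ltW.
have sd : sin d = v / r.
  have : tan d = v / u by rewrite /d atanK.
  rewrite /tan => /(congr1 ( *%R^~ (cos d))); rewrite divfK.
    by move=> ->; rewrite cd; field; rewrite !gt_eqF.
  by rewrite cd mulf_neq0 // ?invr_eq0 gt_eqF.
split=> //.
- rewrite cosD -/r -/c -/s cd sd.
  have -> : r * (c * (u / r) - s * (v / r)) = c * u - s * v by field; rewrite gt_eqF.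
  have -> : c * u - s * v = x * (c ^+ 2 + s ^+ 2) by rewrite /u /v; ring.
  by rewrite cs mulr1.
- rewrite sinD -/r -/c -/s cd sd.
  have -> : r * (s * (u / r) + c * (v / r)) = s * u + c * v by field; rewrite gt_eqF.
  have -> : s * u + c * v = y * (c ^+ 2 + s ^+ 2) by rewrite /u /v; ring.
  by rewrite cs mulr1.
Qed.

(** The polar angle differs from phi by less than a quarter turn at both ends, so it
    varies by more than 2 pi while phi varies by 3 pi, and by exactly 2 pi at some
    intermediate time. *)
Lemma turns_within_of_weighted_angle f g (eps T : R) (x y p q phi : R -> R) :
  0 < eps -> 0 < T -> solution_on f g T x y -> {within `[0, T], continuous phi} ->
  (forall s, 0 <= s <= T -> [/\ 0 < p s, 0 < q s, x s = p s * cos (phi s),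
    y s = q s * sin (phi s) & x s ^+ 2 + y s ^+ 2 < eps ^+ 2]) ->
  3 * pi <= `|phi T - phi 0| -> turns_within f g eps (x 0) (y 0).
Proof.
move=> e0 T0 sol cphi H turn; have [cx cy _] := sol.
pose u s := x s * cos (phi s) + y s * sin (phi s).
pose v s := y s * cos (phi s) - x s * sin (phi s).
pose theta s := phi s + atan (v s / u s).
pose r s := Num.sqrt (x s ^+ 2 + y s ^+ 2).
have K s : 0 <= s <= T -> [/\ 0 < u s, 0 < x s ^+ 2 + y s ^+ 2,
    x s = r s * cos (theta s) & y s = r s * sin (theta s)].
  move=> /H [p0 q0 xE yE _].
  by have := weighted_angle_correction (phi s) p0 q0; rewrite /= -xE -yE.
have ccos : {within `[0, T], continuous (fun s => cos (phi s))}.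
  exact: continuous_within_comp (@continuous_cos R) cphi.
have csin : {within `[0, T], continuous (fun s => sin (phi s))}.
  exact: continuous_within_comp (@continuous_sin R) cphi.
have cth : {within `[0, T], continuous theta}.
  apply: within_continuousD => //; apply: continuous_within_comp.
    by move=> z; exact: continuous_atan.
  apply: within_continuousM.
    by apply: within_continuousB; exact: within_continuousM.
  apply: within_continuousV.
    by apply: within_continuousD; exact: within_continuousM.
  by move=> s /=; rewrite in_itv /= => /K [u0 _ _ _]; rewrite gt_eqF.
have near_phi s : `|theta s - phi s| < pi / 2.
  have -> : theta s - phi s = atan (v s / u s) by rewrite /theta; ring.
  by rewrite ltr_norml atan_gtNpi2 atan_ltpi2.
have := near_phi 0; have := near_phi T; rewrite !ltr_norml => /andP[h1 h2] /andP[h3 h4].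
have pi0 := pi_gt0 R.
have [T' /andP[T'0 T'T] turn'] : exists2 T', 0 <= T' <= T & `|theta T' - theta 0| = 2 * pi.
  move: turn; rewrite ler_normr => /orP[turn|turn].
    have [|c] := @IVT R theta 0 T (theta 0 + 2 * pi) (ltW T0) cth.
      by rewrite ge_min le_max; apply/andP; split; apply/orP; [left|right]; lra.
    rewrite in_itv /= => cT e; exists c => //.
    by rewrite e addrAC subrr add0r ger0_norm // mulr_ge0 // ltW.
  have [|c] := @IVT R theta 0 T (theta 0 - 2 * pi) (ltW T0) cth.
    by rewrite ge_min le_max; apply/andP; split; apply/orP; [right|left]; lra.
  rewrite in_itv /= => cT e; exists c => //.
  by rewrite e addrAC subrr add0r normrN ger0_norm // mulr_ge0 // ltW.
have T'n0 : T' != 0.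
  apply: contra_eq_neq turn' => ->; rewrite subrr normr0 eq_sym.
  by rewrite mulf_neq0 // gt_eqF.
exists T', x, y, r, theta; split; split => //.
- by rewrite lt_neqAle eq_sym T'n0.
- exact: solution_on_le sol.
- by apply: continuous_subspaceW cth; apply: subset_itvl; rewrite bnd_simp.
move=> s /andP[s0 sT]; have sT' : 0 <= s <= T by rewrite s0 (le_trans sT).
have [_ r20 xE yE] := K s sT'; have [_ _ _ _ re] := H s sT'.
split=> //; rewrite sqrtr_gt0 r20 /=.
rewrite -[ltRHS]ger0_norm ?(ltW e0) // -sqrtr_sqr ltr_sqrt //.
exact: exprn_gt0.
Qed.

End Turning.

(** * Definite Hamiltonians give a monodromic origin *)

Section Definite.
Variable R : realType.
Implicit Types (f g : R -> R -> R) (h p : {poly {poly R}}) (t : nat * nat).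

Lemma blow_up_continuous t e w f p r1 K A (r x y : R -> R) :
  blow_up t e w f p r1 K A -> continuous r -> continuous x -> continuous y ->
  (forall s, 0 <= r s <= r1) -> (forall s, `|x s| <= 1) -> (forall s, `|y s| <= 1) ->
  continuous (fun s => A (r s) (x s) (y s)).
Proof.
move=> [[_ K0] _ lip _] cr cx cy br bx by_ s; apply/cvgrPdist_lt => e0 e00.
pose d := e0 / (3 * (K + 1)).
have K1 : 0 < K + 1 by rewrite ltr_wpDl.
have d0 : 0 < d by rewrite divr_gt0 // mulr_gt0.
near=> s'; apply: (le_lt_trans (lip _ _ _ _ _ _ (br s) (br s') (bx s) (bx s') (by_ s) (by_ s'))).
have e0E : e0 = (K + 1) * (d + d + d) by rewrite /d; field; rewrite gt_eqF.
have h1 : `|r s - r s'| < d.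
  by near: s'; have := cr s => /cvgrPdist_lt /(_ d d0).
have h2 : `|x s - x s'| < d.
  by near: s'; have := cx s => /cvgrPdist_lt /(_ d d0).
have h3 : `|y s - y s'| < d.
  by near: s'; have := cy s => /cvgrPdist_lt /(_ d d0).
rewrite e0E; set z := (X in K * X); have z0 : 0 <= z by rewrite !addr_ge0.
have zd : z < d + d + d by rewrite /z; lra.
apply: (@le_lt_trans _ _ ((K + 1) * z)); first by rewrite ler_wpM2r // lerDl.
by rewrite ltr_pM2l.
Unshelve. all: by end_near. Qed.

Lemma blow_up_bounded t e w f p r1 K A r x y : blow_up t e w f p r1 K A ->
  0 <= r <= r1 -> `|x| <= 1 -> `|y| <= 1 -> `|A r x y| <= `|A 0 0 0| + K * 3.
Proof.
move=> [[/andP[r10 r11] K0] _ lip _] rr x1 y1; have /andP[r0 rr1] := rr.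
have := lip r 0 x 0 y 0 rr; rewrite !subr0 lexx (ltW r10) normr0 => /(_ erefl x1 ler01 y1 ler01).
move=> h; have -> : A r x y = A 0 0 0 + (A r x y - A 0 0 0) by ring.
apply: (le_trans (ler_normD _ _)); rewrite lerD2l; apply: (le_trans h).
by rewrite ler_wpM2l // ger0_norm //; lra.
Qed.

Lemma quotient_lip (n n' b b' a mu k1 k2 d : R) : 0 < mu -> `|n'| <= a ->
  mu <= `|b| -> mu <= `|b'| -> `|n - n'| <= k1 * d -> `|b - b'| <= k2 * d ->
  `|n / b - n' / b'| <= (k1 / mu + a * k2 / mu ^+ 2) * d.
Proof.
move=> mu0 na mb mb' hn hb.
have b0 : b != 0 by rewrite -normr_gt0 (lt_le_trans mu0).
have b'0 : b' != 0 by rewrite -normr_gt0 (lt_le_trans mu0).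
have -> : n / b - n' / b' = (n - n') / b + n' * (b' - b) / (b * b').
  by field; rewrite b0 b'0.
apply: (le_trans (ler_normD _ _)); rewrite [leRHS]mulrDl; apply: lerD.
  rewrite normrM normfV mulrAC; apply: ler_pM; rewrite ?invr_ge0 //.
  by rewrite lef_pV2 // posrE normr_gt0.
rewrite !normrM normfV normrM distrC.
have -> : a * k2 / mu ^+ 2 * d = a * (k2 * d) / mu ^+ 2 by ring.
apply: ler_pM; rewrite ?mulr_ge0 ?invr_ge0 ?mulr_ge0 //; first exact: ler_pM.
rewrite lef_pV2 ?posrE ?mulr_gt0 ?exprn_gt0 ?normr_gt0 // expr2.
by apply: ler_pM; rewrite // ltW.
Qed.

Lemma expR_min_lip (l a b : R) : l <= 0 ->
  `|expR (Num.min a l) - expR (Num.min b l)| <= `|a - b|.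
Proof.
move=> l0; wlog ab : a b / a <= b => [W|].
  by have [/W //|/ltW/W] := leP a b; rewrite distrC [leRHS]distrC.
have mab : Num.min a l <= Num.min b l by rewrite le_min !ge_min ab lexx orbT.
rewrite distrC [leRHS]distrC [leRHS]ger0_norm ?subr_ge0 //.
rewrite ger0_norm ?subr_ge0 ?ler_expR //.
set x := Num.min a l in mab *; set y := Num.min b l in mab *.
have y1 : expR y <= 1 by rewrite -[leRHS]expR0 ler_expR /y ge_min l0 orbT.
have yx : y - x <= b - a by rewrite /x /y /Num.min; case: ltP => h1; case: ltP => h2; lra.
apply: le_trans yx.
have := expR_ge1Dx (x - y) => h.
have -> : expR y - expR x = expR y * (1 - expR (x - y)).
  by rewrite mulrBr mulr1 -expRD [y + _]addrC subrK.
have e1 : 0 <= 1 - expR (x - y) by rewrite subr_ge0 -[leRHS]expR0 ler_expR; lra.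
apply: (@le_trans _ _ (1 * (1 - expR (x - y)))); first by rewrite ler_wpM2r.
by rewrite mul1r; lra.
Qed.

Lemma is_derive_polar (u v : R -> R) (s du dv : R) n :
  is_derive s 1 u du -> is_derive s 1 v dv ->
  is_derive s 1 (fun x => expR (u x) ^+ n * cos (v x))
    (expR (u s) ^+ n * (n%:R * du * cos (v s) - dv * sin (v s))) /\
  is_derive s 1 (fun x => expR (u x) ^+ n * sin (v x))
    (expR (u s) ^+ n * (n%:R * du * sin (v s) + dv * cos (v s))).
Proof.
move=> Du Dv.
have De : is_derive s 1 (fun x => expR (u x) ^+ n) (n%:R * du * expR (u s) ^+ n).
  have := @is_derive1_comp R (@expR R) (fun x => n%:R * u x) s _ _ (is_derive_expR _)
    (is_deriveZ n%:R Du).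
  move=> h; apply: (is_derive_pt h) => [x /=|]; first by rewrite expRM_natl.
  by rewrite expRM_natl /GRing.scale /=; ring.
have Dc := @is_derive1_comp R (@cos R) v s _ _ (is_derive_cos _) Dv.
have Ds := @is_derive1_comp R (@sin R) v s _ _ (is_derive_sin _) Dv.
split; [apply: (is_derive_pt (is_deriveM De Dc))|apply: (is_derive_pt (is_deriveM De Ds))] => //;
  by rewrite /GRing.scale /=; ring.
Qed.

(** The chain rule for an orbit given by ln rho and phi as functions of a parameter
    with d phi = sg and d (ln rho) = sg N / B, run at the speed 1 / k.  P1 and P2 stand
    for rho ^ t1 and rho ^ t2, and W for rho ^ w. *)
Lemma weighted_polar_field (t1 t2 c s N B A1 A2 P1 P2 W sg : R) :
  P1 != 0 -> P2 != 0 -> W != 0 -> B != 0 -> sg ^+ 2 = 1 ->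
  t1 * c ^+ 2 + t2 * s ^+ 2 != 0 ->
  N = c * A1 + s * A2 -> B = t1 * c * A2 - t2 * s * A1 ->
  let k := (t1 * c ^+ 2 + t2 * s ^+ 2) * (P1 * P2) / (W * (sg * B)) in
  P1 * (t1 * (sg * N / B * k^-1) * c - sg * k^-1 * s) = W * A1 / P2 /\
  P2 * (t2 * (sg * N / B * k^-1) * s + sg * k^-1 * c) = W * A2 / P1.
Proof.
move=> P10 P20 W0 B0 sg2 D0 NE BE k.
have sg0 : sg != 0 by apply: contra_eq_neq sg2 => ->; rewrite expr0n /= eq_sym oner_eq0.
have kE : sg * k^-1 = W * B / ((t1 * c ^+ 2 + t2 * s ^+ 2) * (P1 * P2)).
  have -> : sg * k^-1 = sg ^+ 2 * (W * B / ((t1 * c ^+ 2 + t2 * s ^+ 2) * (P1 * P2))).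
    by rewrite /k; field; rewrite P10 P20 W0 B0 sg0 D0.
  by rewrite sg2 mul1r.
have -> : sg * N / B * k^-1 = N / B * (sg * k^-1) by ring.
rewrite kE; move: D0 B0; rewrite NE; set D := _ + _ => D0 B0.
split.
- transitivity (W / (D * P2) * (t1 * (c * A1 + s * A2) * c - B * s)).
    by field; rewrite P10 P20 B0 D0.
  have -> : t1 * (c * A1 + s * A2) * c - B * s = D * A1 by rewrite BE /D; ring.
  by field; rewrite P20 D0.
- transitivity (W / (D * P1) * (t2 * (c * A1 + s * A2) * s + B * c)).
    by field; rewrite P10 P20 B0 D0.
  have -> : t2 * (c * A1 + s * A2) * s + B * c = D * A2 by rewrite BE /D; ring.
  by field; rewrite P10 D0.
Qed.

(** A continuous function on the circle without zeros: its sign is constant by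
    connectedness, and it is bounded away from zero by compactness. *)
Lemma periodic_definite (B : R -> R -> R) (m0 : R -> R) : continuous m0 ->
  (forall phi, m0 phi = B (cos phi) (sin phi)) -> (forall phi, m0 phi != 0) ->
  exists sg m, [/\ sg ^+ 2 = 1, 0 < m & forall phi, m <= sg * m0 phi].
Proof.
move=> cm mE m00; pose sg := Num.sg (m0 0).
have sg2 : sg ^+ 2 = 1 by rewrite sqr_sg m00.
have cs : continuous (fun phi => sg * m0 phi).
  by move=> z; apply: cvgM; [exact: cvg_cst|exact: cm].
have pi0 := pi_gt0 R.
have [|c cI cmin] := @EVT_min R (fun phi => sg * m0 phi) (- pi) pi _ (continuous_subspaceT cs).
  by lra.
have pos phi : 0 < sg * m0 phi.
  have p0 : 0 < sg * m0 0 by rewrite -normrEsg normr_gt0.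
  rewrite ltNge; apply/negP => neg.
  have [z z0] : exists z, sg * m0 z = 0.
    have [le|/ltW le] := leP 0 phi.
      have [|z _ ?] := @IVT R (fun phi => sg * m0 phi) 0 phi 0 le (continuous_subspaceT cs).
        by rewrite ge_min le_max neg (ltW p0) orbT.
      by exists z.
    have [|z _ ?] := @IVT R (fun phi => sg * m0 phi) phi 0 0 le (continuous_subspaceT cs).
      by rewrite ge_min le_max neg (ltW p0) orbT.
    by exists z.
  move/eqP: z0; rewrite mulf_eq0 (negPf (m00 z)) orbF sgr_eq0 => z0.
  by move: (m00 0); rewrite z0.
exists sg, (sg * m0 c); split=> // phi.
have [phi' pI [e1 e2]] := unit_angle (cos2Dsin2 phi).
have -> : m0 phi = m0 phi' by rewrite !mE e1 e2.
by apply: cmin; rewrite in_itv.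
Qed.

End Definite.

Section DefiniteMonodromic.
Variable R : realType.
Implicit Types (f g : R -> R -> R) (h p : {poly {poly R}}) (t : nat * nat).

(** N and B are the radial and the angular component of the blown-up field, up to a
    common positive factor.  The orbit is
    obtained from its projection (ln rho as a function of phi, by Picard iteration)
    and from its schedule (the time as a function of phi, then inverted). *)
Lemma definite_monodromic t (w : nat) f g h r1 K1 A1 r2 K2 A2 :
  (0 < t.1)%N -> (0 < t.2)%N -> (0 < w)%N -> quasihom t w%:Z h ->
  blow_up t t.2 w f (- map_poly (@deriv R) h) r1 K1 A1 ->
  blow_up t t.1 w g h^`() r2 K2 A2 ->
  (forall c s : R, c ^+ 2 + s ^+ 2 = 1 -> h.[c, s] != 0) -> monodromic f g.
Proof.
move=> t10 t20 w0 hh bu1 bu2 hdef eps eps0.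
have [[/andP[r10 r11] K10] F1 L1 Z1] := bu1.
have [[/andP[r20 r21] K20] F2 L2 Z2] := bu2.
pose T1 : R := t.1%:R; pose T2 : R := t.2%:R.
have T10 : 0 < T1 by rewrite ltr0n.
have T20 : 0 < T2 by rewrite ltr0n.
pose N r phi := cos phi * A1 r (cos phi) (sin phi) + sin phi * A2 r (cos phi) (sin phi).
pose B r phi := T1 * cos phi * A2 r (cos phi) (sin phi)
  - T2 * sin phi * A1 r (cos phi) (sin phi).
have cm := @cos_max R; have sm := @sin_max R.
have cont_A t' e' f' p' r' K' A' (r phi : R -> R) : blow_up t' e' w f' p' r' K' A' ->
    continuous r -> continuous phi -> (forall s, 0 <= r s <= r') ->
    continuous (fun s => A' (r s) (cos (phi s)) (sin (phi s))).
  move=> bu cr cp br; apply: (blow_up_continuous bu) => //.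
  - by move=> s; apply: continuous_comp; [exact: cp|exact: continuous_cos].
  - by move=> s; apply: continuous_comp; [exact: cp|exact: continuous_sin].
have cont_cos (phi : R -> R) : continuous phi -> continuous (fun s => cos (phi s)).
  by move=> cp s; apply: continuous_comp; [exact: cp|exact: continuous_cos].
have cont_sin (phi : R -> R) : continuous phi -> continuous (fun s => sin (phi s)).
  by move=> cp s; apply: continuous_comp; [exact: cp|exact: continuous_sin].
have contN (r phi : R -> R) : continuous r -> continuous phi ->
    (forall s, 0 <= r s <= Num.min r1 r2) -> continuous (fun s => N (r s) (phi s)).
  move=> cr cp br s; apply: cvgD; apply: cvgM; (apply: cont_cos || apply: cont_sin ||
    apply: cont_A bu1 _ _ _ _ || apply: cont_A bu2 _ _ _ _) => // z;
    by have := br z; rewrite le_min => /andP[z0 /andP[z1 z2]]; rewrite z0.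
have contB (r phi : R -> R) : continuous r -> continuous phi ->
    (forall s, 0 <= r s <= Num.min r1 r2) -> continuous (fun s => B (r s) (phi s)).
  move=> cr cp br s; apply: cvgB; (apply: cvgM; first (apply: cvgM; first exact: cvg_cst));
    (apply: cont_cos || apply: cont_sin ||
    apply: cont_A bu1 _ _ _ _ || apply: cont_A bu2 _ _ _ _) => // z;
    by have := br z; rewrite le_min => /andP[z0 /andP[z1 z2]]; rewrite z0.
have rm0 : 0 < Num.min r1 r2 by rewrite lt_min r10.
(* By Euler's identity the angular component equals w h on the circle r = 0. *)
have B0E phi : B 0 phi = w%:R * h.[cos phi, sin phi].
  rewrite /B Z1 Z2 hornerN hornerN -(quasihom_euler (cos phi) (sin phi) hh).
  by rewrite mulrN opprK.
have [||| sg [m [sg2 m0 mB]]] := @periodic_definite R (fun c s => w%:R * h.[c, s]) (B 0).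
- apply: (contB (fun=> 0) id) => [z|z|z]; [exact: cvg_cst|exact: cvg_id|].
  by rewrite lexx ltW.
- exact: B0E.
- move=> phi; rewrite B0E mulf_neq0 ?pnatr_eq0 -?lt0n // hdef //.
  exact: cos2Dsin2.
pose KB := T1 * K2 + T2 * K1; pose KN := K1 + K2.
have KB0 : 0 <= KB by rewrite addr_ge0 // mulr_ge0 // ltW.
have mul1 (c a : R) b : `|c| <= 1 -> `|a| <= b -> `|c * a| <= b.
  by move=> c1 ab; rewrite normrM -[leRHS]mul1r; apply: ler_pM.
have lipA r r' phi : 0 <= r <= Num.min r1 r2 -> 0 <= r' <= Num.min r1 r2 ->
    `|A1 r (cos phi) (sin phi) - A1 r' (cos phi) (sin phi)| <= K1 * `|r - r'| /\
    `|A2 r (cos phi) (sin phi) - A2 r' (cos phi) (sin phi)| <= K2 * `|r - r'|.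
  rewrite !le_min => /andP[a0 /andP[a1 a2]] /andP[b0 /andP[b1 b2]].
  have e0 (z : R) : `|z - z| = 0 by rewrite subrr normr0.
  split.
    apply: (le_trans (L1 _ _ _ _ _ _ _ _ _ _ _ _)) => //; rewrite ?a0 ?b0 //.
    by rewrite !e0 !addr0.
  apply: (le_trans (L2 _ _ _ _ _ _ _ _ _ _ _ _)) => //; rewrite ?a0 ?b0 //.
  by rewrite !e0 !addr0.
have lipB r r' phi : 0 <= r <= Num.min r1 r2 -> 0 <= r' <= Num.min r1 r2 ->
    `|B r phi - B r' phi| <= KB * `|r - r'|.
  move=> br br'; have [l1 l2] := lipA r r' phi br br'.
  have -> : B r phi - B r' phi =
     T1 * (cos phi * (A2 r (cos phi) (sin phi) - A2 r' (cos phi) (sin phi))) -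
     T2 * (sin phi * (A1 r (cos phi) (sin phi) - A1 r' (cos phi) (sin phi))).
    by rewrite /B; ring.
  apply: (le_trans (ler_normB _ _)).
  rewrite (normrM T1) (normrM T2) (ger0_norm (ltW T10)) (ger0_norm (ltW T20)) /KB mulrDl -!mulrA.
  by apply: lerD; (apply: ler_wpM2l; [exact: ltW|exact: mul1]).
have lipN r r' phi : 0 <= r <= Num.min r1 r2 -> 0 <= r' <= Num.min r1 r2 ->
    `|N r phi - N r' phi| <= KN * `|r - r'|.
  move=> br br'; have [l1 l2] := lipA r r' phi br br'.
  have -> : N r phi - N r' phi =
     cos phi * (A1 r (cos phi) (sin phi) - A1 r' (cos phi) (sin phi)) +
     sin phi * (A2 r (cos phi) (sin phi) - A2 r' (cos phi) (sin phi)).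
    by rewrite /N; ring.
  by apply: (le_trans (ler_normD _ _)); rewrite /KN mulrDl; apply: lerD; exact: mul1.
pose M := (`|A1 0 0 0| + K1 * 3) + (`|A2 0 0 0| + K2 * 3).
have bdN r phi : 0 <= r <= Num.min r1 r2 -> `|N r phi| <= M.
  rewrite le_min => /andP[a0 /andP[a1 a2]].
  apply: (le_trans (ler_normD _ _)); apply: lerD; apply: mul1 => //.
    by apply: (blow_up_bounded bu1) => //; rewrite a0.
  by apply: (blow_up_bounded bu2) => //; rewrite a0.
have M0 : 0 <= M by rewrite !addr_ge0 // mulr_ge0.
(* Up to the radius r3 the angular component stays above half of its minimum at
   r = 0. *)
pose mu := m / 2; have mu0 : 0 < mu by rewrite divr_gt0.
have KB1 : 0 < KB + 1 by rewrite ltr_wpDl.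
pose r3 := Num.min (Num.min r1 r2) (mu / (KB + 1)).
have r30 : 0 < r3 by rewrite lt_min rm0 divr_gt0.
have r3m r : 0 <= r <= r3 -> 0 <= r <= Num.min r1 r2.
  by move=> /andP[->]; rewrite le_min => /andP[-> _].
have r31 : r3 <= 1 by rewrite !ge_min r11.
have lowB r phi : 0 <= r <= r3 -> mu <= sg * B r phi.
  move=> br; have /andP[a0 ar] := br.
  have close : `|B r phi - B 0 phi| <= mu.
    apply: (le_trans (lipB _ _ _ (r3m _ br) _)); first by rewrite lexx ltW.
    rewrite subr0 ger0_norm //; apply: (@le_trans _ _ ((KB + 1) * r)).
      by rewrite ler_wpM2r // lerDl.
    by rewrite mulrC -ler_pdivlMr //; move: ar; rewrite le_min => /andP[].
  have sg1 : `|sg| = 1.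
    apply/eqP; rewrite -(@eqrXn2 _ 2) // expr1n real_normK ?num_real //; exact/eqP.
  have : `|sg * (B r phi - B 0 phi)| <= mu by rewrite normrM sg1 mul1r.
  rewrite mulrBr ler_norml => /andP[h1 _]; have := mB phi.
  by move: h1; rewrite /mu => h1 hm; lra.
have lowB' r phi : 0 <= r <= r3 -> mu <= `|B r phi|.
  move=> br; apply: (le_trans (lowB r phi br)); apply: (le_trans (ler_norm _)).
  rewrite normrM (_ : `|sg| = 1) ?mul1r //.
  apply/eqP; rewrite -(@eqrXn2 _ 2) // expr1n real_normK ?num_real //; exact/eqP.
(* Truncating ln rho at ln r3 makes the scalar equation globally Lipschitz; the
   solutions of interest never reach the truncation. *)
pose l3 := ln r3.
have l30 : l3 <= 0 by exact: ln_le0.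
pose rc u := expR (Num.min u l3).
have rcb u : 0 <= rc u <= r3.
  by rewrite expR_ge0 /= -[leRHS]lnK ?posrE // ler_expR ge_min lexx orbT.
pose C := M / mu; pose L := (KN / mu + M * KB / mu ^+ 2) + 1.
have C0 : 0 <= C by rewrite divr_ge0 // ltW.
have mu0' := ltW mu0; have KN0 : 0 <= KN by exact: addr_ge0.
have L'0 : 0 <= KN / mu + M * KB / mu ^+ 2.
  apply: addr_ge0; first exact: divr_ge0.
  by apply: divr_ge0; [exact: mulr_ge0|exact: exprn_ge0].
have Lpos : 0 < L by rewrite ltr_wpDl.
pose rm := Num.min r3 (eps / 2).
have rmp : 0 < rm by rewrite lt_min r30 divr_gt0.
(* ln rho varies at most at the rate C, hence by at most 4 pi C over two turns. *)
have [d d0 Hd] := @weighted_polar R t.1 t.2 (rm * expR (- (C * (4 * pi)))) t10 t20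
  (mulr_gt0 rmp (expR_gt0 _)).
exists d => // a b /Hd [rho0 [phi0 [/andP[rho00 rho0l] aE bE]]].
pose ph s := phi0 + sg * s.
have phc : continuous ph.
  move=> z; apply: cvgD; first exact: cvg_cst.
  by apply: cvgM; [exact: cvg_cst|exact: cvg_id].
pose G u s := sg * N (rc u) (ph s) / B (rc u) (ph s).
have sg1 : `|sg| = 1.
  apply/eqP; rewrite -(@eqrXn2 _ 2) // expr1n real_normK ?num_real //; exact/eqP.
have Bn0 r phi : 0 <= r <= r3 -> B r phi != 0.
  by move=> br; rewrite -normr_gt0; apply: lt_le_trans (lowB' _ _ br).
have GC u s : `|G u s| <= C.
  rewrite /G !normrM sg1 mul1r normfV; apply: ler_pM; rewrite ?invr_ge0 //.
    by apply: bdN; exact: r3m.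
  rewrite lef_pV2 ?posrE ?lowB' //; apply: lt_le_trans mu0 _; exact: lowB'.
have GL u v s : `|G u s - G v s| <= L * `|u - v|.
  have -> : G u s - G v s = sg * (N (rc u) (ph s) / B (rc u) (ph s) -
     N (rc v) (ph s) / B (rc v) (ph s)) by rewrite /G; ring.
  rewrite normrM sg1 mul1r.
  apply: (le_trans (quotient_lip mu0 (bdN _ (ph s) (r3m _ (rcb v)))
    (lowB' _ _ (rcb u)) (lowB' _ _ (rcb v))
    (lipN _ _ _ (r3m _ (rcb u)) (r3m _ (rcb v)))
    (lipB _ _ _ (r3m _ (rcb u)) (r3m _ (rcb v))))).
  apply: ler_pM => //; rewrite ?lerDl //; last exact: expR_min_lip.
have rcc (y : R -> R) : continuous y -> continuous (fun s => rc (y s)).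
  move=> cy; have rcc0 : continuous rc.
    by apply: (@lipschitz_continuous _ _ 1) => s s'; rewrite mul1r; exact: expR_min_lip.
  by move=> z; apply: continuous_comp; [exact: cy|exact: rcc0].
have Gcont (y : R -> R) : continuous y -> continuous (fun s => G (y s) s).
  move=> cy s; rewrite /G; apply: cvgM.
    apply: cvgM; first exact: cvg_cst.
    by apply: (contN (fun s => rc (y s)) ph) => // [|z]; [exact: rcc|exact: r3m].
  apply: cvgV; first exact: Bn0.
  by apply: (contB (fun s => rc (y s)) ph) => // [|z]; [exact: rcc|exact: r3m].
have [y [y0 ylip yD]] := picard (ln rho0) Lpos GC GL Gcont.
have yc := lipschitz_continuous ylip.
pose D s := T1 * cos (ph s) ^+ 2 + T2 * sin (ph s) ^+ 2.
have Dpos s : 0 < D s.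
  rewrite /D; have := cos2Dsin2 (ph s).
  have := sqr_ge0 (cos (ph s)); have := sqr_ge0 (sin (ph s)).
  move: (cos _ ^+ 2) (sin _ ^+ 2) => c2 s2 s20 c20 cs.
  have [c0|c0] := eqVneq c2 0; first by move: cs; rewrite c0 mulr0 !add0r => ->; rewrite mulr1.
  by rewrite ltr_wpDr ?mulr_ge0 ?(ltW T20) // mulr_gt0 // lt_neqAle eq_sym c0.
pose E s := rc (y s).
have E0 s : 0 < E s by exact: expR_gt0.
pose k s := D s * (E s ^+ t.1 * E s ^+ t.2) / (E s ^+ w * (sg * B (E s) (ph s))).
have Bpos s : 0 < sg * B (E s) (ph s) by exact: (lt_le_trans mu0 (lowB _ _ (rcb (y s)))).
have kpos s : 0 < k s.
  by apply: divr_gt0; apply: mulr_gt0 => //; [apply: mulr_gt0|]; exact: exprn_gt0.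
have Ec : continuous E by exact: rcc.
have EXc n : continuous (fun s => E s ^+ n).
  move=> z; apply: (@continuous_comp _ _ _ E (fun x => x ^+ n)); first exact: Ec.
  exact: exprn_continuous.
have kc : continuous k.
  move=> z; rewrite /k; apply: cvgM.
    apply: cvgM; last by apply: cvgM; exact: EXc.
    have sqc (u : R -> R) : continuous u -> continuous (fun s => u s ^+ 2).
      move=> cu x; apply: (@continuous_comp _ _ _ u (fun x => x ^+ 2)); first exact: cu.
      exact: exprn_continuous.
    apply: cvgD; (apply: cvgM; first exact: cvg_cst).
      exact: (sqc (fun s => cos (ph s)) (cont_cos ph phc)).
    exact: (sqc (fun s => sin (ph s)) (cont_sin ph phc)).
  apply: cvgV; first by rewrite mulf_neq0 // gt_eqF // exprn_gt0.
  apply: cvgM; first exact: EXc.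
  apply: cvgM; first exact: cvg_cst.
  by apply: (contB E ph) => // x; exact: (r3m _ (rcb (y x))).
have [F0 DF0] := antiderivative kc.
pose F s := F0 s - F0 0.
have DF (s : R) : -1 < s -> is_derive s 1 F (k s).
  move=> s1; apply: (is_derive_pt (is_deriveD (DF0 s s1) (is_derive_cst (- F0 0) s 1))) => //.
  by rewrite addr0.
have pi0 := pi_gt0 R.
have Lp : 0 < 4 * pi :> R by lra.
have [] := inverse_function Lp kpos DF.
have -> : F 0 = 0 by rewrite /F subrr.
set T := F (4 * pi) => T0 [psi [psi0 psiT psib psic psiD]].
have ysmall s : 0 <= s <= 4 * pi -> y s <= ln rm.
  move=> /andP[s0 s4]; have := ylip s 0; rewrite subr0 [`|s|]ger0_norm // y0 ler_norml => /andP[_ yu].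
  have h2 : ln rho0 <= ln rm - C * (4 * pi).
    rewrite -ler_expR lnK ?posrE // expRD lnK ?posrE //; exact: ltW.
  have : C * s <= C * (4 * pi) by rewrite ler_wpM2l.
  lra.
have rm3 : ln rm <= l3 by rewrite ler_ln ?posrE // ge_min lexx.
have EE s : 0 <= s <= 4 * pi -> E s = expR (y s).
  by move=> sb; rewrite /E /rc (min_idPl _) //; apply: le_trans rm3; exact: ysmall.
have Esm s : 0 <= s <= 4 * pi -> expR (y s) <= rm.
  by move=> sb; rewrite -[leRHS]lnK ?posrE // ler_expR; exact: ysmall.
pose X z := expR (y (psi z)) ^+ t.1 * cos (ph (psi z)).
pose Y z := expR (y (psi z)) ^+ t.2 * sin (ph (psi z)).
have aX : X 0 = a by rewrite /X psi0 /ph mulr0 addr0 y0 lnK ?posrE.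
have bY : Y 0 = b by rewrite /Y psi0 /ph mulr0 addr0 y0 lnK ?posrE.
rewrite -aX -bY.
have cyp : {within `[0, T], continuous (fun z : R => y (psi z))}.
  exact: continuous_within_comp yc psic.
have cpp : {within `[0, T], continuous (fun z : R => ph (psi z))}.
  exact: continuous_within_comp phc psic.
have cEn n : {within `[0, T], continuous (fun z : R => expR (y (psi z)) ^+ n)}.
  apply: (@continuous_within_comp _ _ (fun x => expR x ^+ n)) => // z.
  apply: (@continuous_comp _ _ _ expR (fun x => x ^+ n)); first exact: continuous_expR.
  exact: exprn_continuous.
apply: (@turns_within_of_weighted_angle R f g eps T X Y
  (fun z => expR (y (psi z)) ^+ t.1) (fun z => expR (y (psi z)) ^+ t.2)
  (fun z => ph (psi z))) => //.
- split.
  + apply: within_continuousM => //.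
    exact: continuous_within_comp (@continuous_cos R) cpp.
  + apply: within_continuousM => //.
    exact: continuous_within_comp (@continuous_sin R) cpp.
  move=> z /[dup] zT /psiD [/andP[p0 p4] Dpsi].
  have pb : 0 <= psi z <= 4 * pi by rewrite !ltW.
  have Du := @is_derive1_comp R y psi z _ _ (yD _ p0) Dpsi.
  have Dv : is_derive z 1 (fun z => ph (psi z)) (sg * (k (psi z))^-1).
    apply: (is_derive_pt (is_deriveD (is_derive_cst phi0 z 1) (is_deriveZ sg Dpsi))) => //.
    by rewrite add0r.
  have rb : 0 <= expR (y (psi z)) <= r3 by rewrite -EE //; exact: rcb.
  have rb0 : 0 < expR (y (psi z)) <= r3 by rewrite expR_gt0; case/andP: rb.
  have P0 n : expR (y (psi z)) ^+ n != 0 by rewrite expf_neq0 // gt_eqF // expR_gt0.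
  have [X' Y'] := weighted_polar_field (c := cos (ph (psi z))) (s := sin (ph (psi z)))
    (t1 := T1) (t2 := T2) (P0 t.1) (P0 t.2) (P0 w) (Bn0 _ (ph (psi z)) rb) sg2
    (lt0r_neq0 (Dpos (psi z))) (erefl _) (erefl _).
  have kE : k (psi z) = D (psi z) * (expR (y (psi z)) ^+ t.1 * expR (y (psi z)) ^+ t.2) /
    (expR (y (psi z)) ^+ w * (sg * B (expR (y (psi z))) (ph (psi z)))) by rewrite /k EE.
  have GE : G (y (psi z)) (psi z) = sg * N (expR (y (psi z))) (ph (psi z)) /
     B (expR (y (psi z))) (ph (psi z)) by rewrite /G -/(E (psi z)) EE.
  have rb12 : 0 < expR (y (psi z)) <= r1 /\ 0 < expR (y (psi z)) <= r2.
    by move: rb0 => /andP[->]; rewrite !le_min => /andP[/andP[-> ->]].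
  have [D1 _] := is_derive_polar t.1 Du Dv; have [_ D2] := is_derive_polar t.2 Du Dv.
  split.
  + apply: (is_derive_pt D1) => //; rewrite /= GE kE; apply: etrans X' _.
    apply: (mulfI (P0 t.2)); rewrite F1 //; last by case: rb12.
    by rewrite mulrC divfK.
  + apply: (is_derive_pt D2) => //; rewrite /= GE kE; apply: etrans Y' _.
    apply: (mulfI (P0 t.1)); rewrite F2 //; last by case: rb12.
    by rewrite mulrC divfK.
- move=> z zT; have pb := psib z zT.
  have e0 := expR_gt0 (y (psi z)); have em := Esm _ pb.
  have pw n : (0 < n)%N -> expR (y (psi z)) ^+ n <= eps / 2.
    move=> n0; have : rm <= eps / 2 by rewrite ge_min lexx orbT.
    apply: le_trans; apply: (le_trans _ em); rewrite -[leRHS]expr1.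
    by apply: ler_wiXn2l => //; apply: (le_trans em); rewrite ge_min r31.
  split; rewrite ?exprn_gt0 //.
  have e2 : 0 < eps / 2 by rewrite divr_gt0.
  have sq (c : R) n : (0 < n)%N -> (expR (y (psi z)) ^+ n * c) ^+ 2 <= (eps / 2) ^+ 2 * c ^+ 2.
    move=> n0; rewrite exprMn ler_wpM2r ?sqr_ge0 //.
    by rewrite lerXn2r // ?nnegrE ?pw // ltW // exprn_gt0.
  have s1 := sq (cos (ph (psi z))) t.1 t10; have s2 := sq (sin (ph (psi z))) t.2 t20.
  apply: (le_lt_trans (lerD s1 s2)); rewrite -mulrDr cos2Dsin2 mulr1.
  by rewrite ltrXn2r // ?ltW //; lra.
- rewrite /ph psi0 psiT opprD addrACA subrr add0r mulr0 subr0 normrM sg1 mul1r.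
  by rewrite ger0_norm; lra.
Qed.

End DefiniteMonodromic.

(** * Sectors that trap the flow *)

Section Trapping.
Variable R : realType.
Implicit Types (f g H : R -> R -> R).

(** Extending an orbit by constants outside its time interval avoids reasoning in
    the subspace topology of the interval. *)
Lemma clamped_continuous (T : R) (u : R -> R) : 0 <= T -> {within `[0, T], continuous u} ->
  continuous (fun s => u (Num.max 0 (Num.min s T))).
Proof.
move=> T0 cu s; set c := fun s => Num.max 0 (Num.min s T).
have cT z : `[0, T]%classic (c z).
  by rewrite /= in_itv /= /c le_max lexx /= ge_max T0 ge_min lexx orbT.
have clip z z' : `|c z - c z'| <= `|z - z'|.
  apply: (le_trans (max0_lip _ _)).
  wlog zz : z z' / z <= z' => [W|].
    by have [/W //|/ltW/W] := leP z z'; rewrite distrC [leRHS]distrC.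
  rewrite distrC [leRHS]distrC [leRHS]ger0_norm ?subr_ge0 //.
  rewrite ger0_norm; last by rewrite subr_ge0 le_min !ge_min zz lexx orbT.
  by rewrite /Num.min; case: ltP => h1; case: ltP => h2; lra.
apply/cvgrPdist_lt => e e0.
have := (subspace_continuousP _ _).1 cu (c s) (cT s) => /cvgrPdist_lt /(_ e e0).
rewrite near_simpl -nbhs_nearE => /nbhs_ballP [d /= d0 H].
apply/nbhs_ballP; exists d => //= z; rewrite /ball /= => zd.
have B : ball (c s) d (c z) by exact: le_lt_trans (clip s z) zd.
exact: H B (cT z).
Qed.

Lemma continuous_induction (T : R) (P : R -> Prop) : P 0 ->
  (forall s, 0 <= s < T -> P s -> exists2 e, 0 < e & forall v, `|s - v| < e -> P v) ->
  (forall s, 0 < s < T -> (forall v, 0 <= v < s -> P v) -> P s) ->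
  forall s, 0 <= s < T -> P s.
Proof.
move=> P0 Popen Pclosed s /andP[s0 sT]; apply: contrapT => nPs.
pose S := [set z | 0 <= z <= s /\ forall v, 0 <= v <= z -> P v].
have S0 : S 0.
  by split; [rewrite lexx|move=> v /andP[v0 v1]; have -> : v = 0 by apply/eqP; rewrite eq_le v0 v1].
have hs : has_sup S by split; [exists 0|exists s => z [/andP[_ zs] _]].
pose z := sup S.
have z0 : 0 <= z by apply: sup_upper_bound.
have zs : z <= s by apply: ge_sup; [exists 0|move=> v [/andP[_ vs] _]].
have below v : 0 <= v < z -> P v.
  move=> /andP[v0 vz]; have [|y [yb Py] vy] := @sup_adherent R S (z - v) _ hs.
    by rewrite subr_gt0.
  by apply: Py; rewrite v0 ltW //; move: vy; rewrite -/z; lra.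
have Pz : P z.
  move: z0; rewrite le_eqVlt => /predU1P[<- //|z0].
  by apply: Pclosed => //; rewrite z0 (le_lt_trans zs).
have zs' : z < s by rewrite lt_neqAle zs andbT; apply/eqP => zE; rewrite zE in Pz.
have [|e e0 He] := Popen z _ Pz; first by rewrite z0 (lt_trans zs').
pose y := Num.min s (z + e / 2).
have Sy : S y.
  split.
    have ze : 0 <= z + e / 2 by rewrite addr_ge0 // divr_ge0 // ltW.
    by rewrite le_min s0 ze ge_min lexx.
  move=> v /andP[v0 vy]; have [vz|zv] := ltP v z; first by apply: below; rewrite v0.
  apply: He; rewrite distrC ger0_norm ?subr_ge0 //.
  have yz : y <= z + e / 2 by rewrite ge_min lexx orbT.
  by lra.
have := sup_upper_bound hs Sy; rewrite -/z leNgt lt_min zs' /=.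
by rewrite ltrDl divr_gt0.
Qed.

Lemma pos_derive_lt_left (u : R -> R) (s l : R) : is_derive s 1 u l -> 0 < l -> u s = 0 ->
  exists2 e, 0 < e & forall v, s - e < v < s -> u v < 0.
Proof.
move=> /is_derive1_caratheodory [q [uE cq qs]] l0 us.
have := cq => /cvgrPdist_lt /(_ l l0); rewrite near_simpl -nbhs_nearE.
move=> /nbhs_ballP [e /= e0 He]; exists e => // v /andP[v1 v2].
have := uE v; rewrite us subr0 => ->.
have vb : ball s e v by rewrite /ball /= ger0_norm; lra.
have := He v vb; rewrite /= qs ltr_norml => /andP[_ h].
by rewrite pmulr_rlt0; lra.
Qed.

Lemma continuous_nonneg_left (u : R -> R) (s : R) : {for s, continuous u} -> 0 < s ->
  (forall v, 0 <= v < s -> 0 <= u v) -> 0 <= u s.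
Proof.
move=> cu s0 H; rewrite leNgt; apply/negP => us.
have := cu => /cvgrPdist_lt /(_ (- u s)); rewrite oppr_gt0 => /(_ us).
rewrite near_simpl -nbhs_nearE => /nbhs_ballP [e /= e0 He].
pose v := Num.max 0 (s - e / 2).
have vs : v < s by rewrite gt_max s0 /=; lra.
have v0 : 0 <= v by rewrite le_max lexx.
have vb : ball s e v.
  rewrite /ball /= ger0_norm ?subr_ge0 ?(ltW vs) //.
  have : s - e / 2 <= v by rewrite le_max lexx orbT.
  lra.
have := He v vb; have := H v; rewrite v0 vs => /(_ erefl) uv.
by rewrite ltr_norml => /andP[h1 h2]; lra.
Qed.

Lemma continuous_pos_near (u : R -> R) (s : R) : {for s, continuous u} -> 0 < u s ->
  exists2 e, 0 < e & forall v, `|s - v| < e -> 0 < u v.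
Proof.
move=> cu us; have := cu => /cvgrPdist_lt /(_ (u s) us).
rewrite near_simpl -nbhs_nearE => /nbhs_ballP [e /= e0 He]; exists e => // v sv.
by have := He v sv; rewrite ltr_norml => /andP[h1 h2]; lra.
Qed.

(** The graphs y = k x ^ (t2 / t1) are the weighted rays of the half-plane x > 0. *)
Definition ratpow (t1 t2 : nat) (x : R) : R := expR (t2%:R / t1%:R * ln x).

Lemma ratpow_exp t1 t2 x : (0 < t1)%N -> 0 < x -> ratpow t1 t2 x ^+ t1 = x ^+ t2.
Proof.
move=> t10 x0; rewrite /ratpow -expRM_natl mulrA mulrCA divff ?pnatr_eq0 -?lt0n //.
by rewrite mulr1 expRM_natl lnK.
Qed.

Lemma continuous_ratpow t1 t2 (x : R) : 0 < x -> {for x, continuous (ratpow t1 t2)}.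
Proof.
move=> x0; apply: continuous_comp; last exact: continuous_expR.
by apply: cvgM; [exact: cvg_cst|exact: continuous_ln].
Qed.

Lemma is_derive_ratpow t1 t2 (X : R -> R) (s dX : R) : 0 < X s -> is_derive s 1 X dX ->
  is_derive s 1 (fun s => ratpow t1 t2 (X s)) (t2%:R / t1%:R * ratpow t1 t2 (X s) / X s * dX).
Proof.
move=> X0 DX; have Dl := @is_derive1_comp R (@ln R) X s _ _ (is_derive1_ln X0) DX.
have := @is_derive1_comp R (@expR R) (fun s => t2%:R / t1%:R * ln (X s)) s _ _
  (is_derive_expR _) (is_deriveZ (t2%:R / t1%:R) Dl).
move=> h; apply: (is_derive_pt h) => //; rewrite /ratpow /GRing.scale /=; ring.
Qed.

(** Both boundary curves are crossed inwards only.  The sector could otherwise be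
    left only through the origin, where its two sides meet. *)
Lemma sector_trap (t1 t2 : nat) (T k1 k2 : R) (X Y dX dY : R -> R) :
  (0 < t1)%N -> (0 < t2)%N -> 0 < T -> continuous X -> continuous Y ->
  (forall s : R, 0 < s < T -> is_derive s 1 X (dX s) /\ is_derive s 1 Y (dY s)) ->
  (forall s, 0 <= s <= T -> 0 < X s ^+ 2 + Y s ^+ 2) ->
  (forall s, 0 < s < T -> 0 < X s -> Y s = k1 * ratpow t1 t2 (X s) ->
     0 < t1%:R * X s * dY s - t2%:R * Y s * dX s) ->
  (forall s, 0 < s < T -> 0 < X s -> Y s = k2 * ratpow t1 t2 (X s) ->
     t1%:R * X s * dY s - t2%:R * Y s * dX s < 0) ->
  0 < X 0 -> k1 * ratpow t1 t2 (X 0) < Y 0 < k2 * ratpow t1 t2 (X 0) ->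
  forall s, 0 <= s <= T -> 0 < X s.
Proof.
move=> t10 t20 T0 cX cY D n0 bar1 bar2 X0 Y0.
pose P s := 0 < X s /\ k1 * ratpow t1 t2 (X s) < Y s < k2 * ratpow t1 t2 (X s).
have cr k s : 0 < X s -> {for s, continuous (fun s => k * ratpow t1 t2 (X s))}.
  move=> Xs; apply: cvgM; first exact: cvg_cst.
  apply: (@continuous_comp _ _ _ X (ratpow t1 t2)); [exact: cX|exact: continuous_ratpow].
have c1 s : 0 < X s -> {for s, continuous (fun s => Y s - k1 * ratpow t1 t2 (X s))}.
  by move=> Xs; apply: cvgB; [exact: cY|exact: cr].
have c2 s : 0 < X s -> {for s, continuous (fun s => k2 * ratpow t1 t2 (X s) - Y s)}.
  by move=> Xs; apply: cvgB; [exact: cr|exact: cY].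
have clos s : 0 < s <= T -> (forall v, 0 <= v < s -> P v) ->
    [/\ 0 < X s, 0 <= Y s - k1 * ratpow t1 t2 (X s) & 0 <= k2 * ratpow t1 t2 (X s) - Y s].
  move=> /andP[s0 sT] H; have Xs : 0 < X s.
    rewrite lt_neqAle; apply/andP; split; last first.
      by apply: (continuous_nonneg_left (cX s)) => // v vb; have [/ltW] := H v vb.
    apply/eqP => X0s.
    pose k := Num.max `|k1| `|k2|.
    have : 0 <= k ^+ t1 * X s ^+ t2 - `|Y s| ^+ t1.
      apply: (@continuous_nonneg_left (fun s => k ^+ t1 * X s ^+ t2 - `|Y s| ^+ t1)) => //.
        apply: cvgB.
          apply: cvgM; first exact: cvg_cst.
          by apply: (@continuous_comp _ _ _ X (fun x => x ^+ t2)); [exact: cX|exact: exprn_continuous].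
        apply: (@continuous_comp _ _ _ (fun s => `|Y s|) (fun x => x ^+ t1)).
          by apply: cvg_norm; exact: cY.
        exact: exprn_continuous.
      move=> v vb; have [Xv /andP[y1 y2]] := H v vb; rewrite subr_ge0 -(ratpow_exp t2 t10 Xv) -exprMn.
      have rp : 0 < ratpow t1 t2 (X v) by exact: expR_gt0.
      rewrite lerXn2r // ?nnegrE ?mulr_ge0 ?(ltW rp) //; first by rewrite le_max normr_ge0.
      have l1 : - k <= k1.
        by rewrite lerNl; apply: le_trans (ler_norm _) _; rewrite normrN le_max lexx.
      have l2 : k2 <= k by apply: le_trans (ler_norm _) _; rewrite le_max lexx orbT.
      rewrite ler_norml -mulNr; apply/andP; split.
        by apply: le_trans (ltW y1); rewrite ler_pM2r.
      by apply: (le_trans (ltW y2)); rewrite ler_pM2r.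
    (* The bound |Y| ^ t1 <= k ^ t1 X ^ t2 of the sector forces Y = 0 with X = 0. *)
    rewrite -X0s expr0n gtn_eqF // mulr0 sub0r oppr_ge0 => Yle.
    have := n0 s; rewrite sT (ltW s0) -X0s expr0n add0r => /(_ erefl).
    suff -> : Y s = 0 by rewrite expr0n ltxx.
    have : `|Y s| ^+ t1 == 0 by rewrite eq_le Yle exprn_ge0.
    by rewrite expf_eq0 t10 normr_eq0 => /eqP.
  split=> //.
    by apply: (continuous_nonneg_left (c1 s Xs)) => // v vb; have [_ /andP[/ltW h _]] := H v vb; rewrite subr_ge0.
  by apply: (continuous_nonneg_left (c2 s Xs)) => // v vb; have [_ /andP[_ /ltW h]] := H v vb; rewrite subr_ge0.
have Pall s : 0 <= s < T -> P s.
  apply: continuous_induction; first by split.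
  - move=> {}s _ [Xs /andP[y1 y2]].
    have [e1 e10 H1] := continuous_pos_near (cX s) Xs.
    have [|e2 e20 H2] := continuous_pos_near (c1 s Xs); first by rewrite subr_gt0.
    have [|e3 e30 H3] := continuous_pos_near (c2 s Xs); first by rewrite subr_gt0.
    exists (Num.min e1 (Num.min e2 e3)); first by rewrite !lt_min e10 e20.
    move=> v; rewrite !lt_min => /andP[/H1 Xv /andP[/H2 v1 /H3 v2]].
    by split=> //; rewrite -subr_gt0 v1 -subr_gt0.
  - move=> {}s /[dup] sT /andP[s0 s1] H; have [|Xs h1 h2] := clos s _ H.
      by rewrite s0 ltW.
    have [DX DY] := D s sT.
    have r0 : 0 < ratpow t1 t2 (X s) by exact: expR_gt0.
    have t1p : 0 < t1%:R :> R by rewrite ltr0n.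
    (* On a weighted ray, the derivative of Y - k X ^ (t2 / t1) is a positive multiple
       of the cross product in the hypotheses. *)
    have key k : Y s = k * ratpow t1 t2 (X s) ->
        dY s - k * (t2%:R / t1%:R * ratpow t1 t2 (X s) / X s * dX s) =
        (t1%:R * X s * dY s - t2%:R * Y s * dX s) / (t1%:R * X s).
      by move=> ->; field; rewrite !gt_eqF.
    have pX : 0 < (t1%:R * X s)^-1 by rewrite invr_gt0 mulr_gt0.
    split=> //; apply/andP; split; rewrite lt_neqAle -subr_ge0 ?h1 ?h2 andbT;
      apply/eqP => yE.
    + have DU : is_derive s 1 (fun s => Y s - k1 * ratpow t1 t2 (X s))
          (dY s - k1 * (t2%:R / t1%:R * ratpow t1 t2 (X s) / X s * dX s)).
        exact: is_deriveB DY (is_deriveZ k1 (is_derive_ratpow t1 t2 Xs DX)).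
      have [||e e0 He] := pos_derive_lt_left DU.
      * by rewrite key // mulr_gt0 // bar1.
      * by rewrite -yE subrr.
      pose v := Num.max 0 (s - e / 2).
      have vs : v < s by rewrite gt_max s0 /=; lra.
      have v0 : 0 <= v by rewrite le_max lexx.
      have ve : s - e / 2 <= v by rewrite le_max lexx orbT.
      have [|_ /andP[y1 _]] := H v; first by rewrite v0.
      by have := He v; rewrite vs andbT => /(_ _); lra.
    + have DU : is_derive s 1 (fun s => k2 * ratpow t1 t2 (X s) - Y s)
          (k2 * (t2%:R / t1%:R * ratpow t1 t2 (X s) / X s * dX s) - dY s).
        exact: is_deriveB (is_deriveZ k2 (is_derive_ratpow t1 t2 Xs DX)) DY.
      have [||e e0 He] := pos_derive_lt_left DU.
      * by rewrite -opprB oppr_gt0 key // nmulr_rlt0 // bar2.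
      * by rewrite yE subrr.
      pose v := Num.max 0 (s - e / 2).
      have vs : v < s by rewrite gt_max s0 /=; lra.
      have v0 : 0 <= v by rewrite le_max lexx.
      have ve : s - e / 2 <= v by rewrite le_max lexx orbT.
      have [|_ /andP[_ y2]] := H v; first by rewrite v0.
      by have := He v; rewrite vs andbT => /(_ _); lra.
move=> s /andP[s0]; rewrite le_eqVlt => /predU1P[->|sT].
  by have [|v /andP[v0 vT]|] := clos T; [rewrite T0 lexx|apply: Pall; rewrite v0|].
by have [] := Pall s; rewrite ?s0.
Qed.

End Trapping.

(** * Propagation of the sign of the Hamiltonian *)

Section Monodromy.
Variable R : realType.
Implicit Types (f g H : R -> R -> R) (t : nat * nat).

Lemma turn_angle (T al : R) (theta : R -> R) : 0 <= T -> {within `[0, T], continuous theta} ->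
  `|theta T - theta 0| = 2 * pi -> 0 <= al <= 2 * pi ->
  exists sg s, [/\ sg = 1 \/ sg = -1, 0 <= s <= T & theta s = theta 0 + sg * al].
Proof.
move=> T0 cth turn /andP[al0 al1]; have pi0 := pi_gt0 R.
have [le|lt] := leP 0 (theta T - theta 0).
  move: turn; rewrite ger0_norm // => turn.
  have [|s sT e] := @IVT R theta 0 T (theta 0 + al) T0 cth.
    by rewrite ge_min le_max; apply/andP; split; apply/orP; [left|right]; lra.
  by exists 1, s; split; [left|move: sT; rewrite in_itv|rewrite mul1r].
move: turn; rewrite ltr0_norm // => turn.
have [|s sT e] := @IVT R theta 0 T (theta 0 - al) T0 cth.
  by rewrite ge_min le_max; apply/andP; split; apply/orP; [right|left]; lra.
by exists (-1), s; split; [right|move: sT; rewrite in_itv|rewrite mulN1r].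
Qed.

(** The change of variables (x, y) to (y, - x), which brings the upper half-plane to
    the right one.  The field (f, g) becomes (quarter_turn g, - quarter_turn f), and
    the weights are exchanged. *)
Definition quarter_turn f : R -> R -> R := fun x y => f (- y) x.

Lemma monodromic_quarter_turn f g : monodromic f g ->
  monodromic (quarter_turn g) (fun x y => - quarter_turn f x y).
Proof.
move=> mono eps e0; have [d d0 Hd] := mono eps e0; exists d => // a b ab.
have [|T [x [y [rho [theta [[T0 [x0 y0] [cx cy D]] [cth K turn]]]]]]] := Hd (- b) a.
  by rewrite sqrrN addrC.
exists T, y, (fun s => - x s), rho, (fun s => theta s - pi / 2).
split; split => //.
- by rewrite x0 y0 opprK.
- split=> //.
  + by move=> s; apply: cvgN; exact: cx.
  + move=> s /D [Dx Dy]; rewrite /quarter_turn opprK; split=> //.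
    exact: is_deriveN.
- by move=> s; apply: cvgB; [exact: cth|exact: cvg_cst].
- by move=> s /K [r1 xE yE]; rewrite cosBpihalf sinBpihalf mulrN xE yE.
- by have -> : theta T - pi / 2 - (theta 0 - pi / 2) = theta T - theta 0 by ring.
Qed.

(** Near the origin, the flow crosses every weighted ray on which H does not vanish
    in the direction given by the sign of H: the bracket is the cross product of the
    tangent (t1 x, t2 y) of the ray with the velocity (f, g).  The factor sg treats
    both signs at once. *)
Definition turns_like t H f g : Prop := forall x y sg, 0 < sg * H x y ->
  exists2 e, 0 < e & forall r, 0 < r < e -> 0 < sg *
    (t.1%:R * (r ^+ t.1 * x) * g (r ^+ t.1 * x) (r ^+ t.2 * y) -
     t.2%:R * (r ^+ t.2 * y) * f (r ^+ t.1 * x) (r ^+ t.2 * y)).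

Definition weighted t (w : nat) H : Prop := forall r x y,
  H (r ^+ t.1 * x) (r ^+ t.2 * y) = r ^+ w * H x y.

Lemma turns_like_quarter_turn t H f g : turns_like t H f g ->
  turns_like (t.2, t.1) (quarter_turn H) (quarter_turn g)
    (fun x y => - quarter_turn f x y).
Proof.
move=> tl x y sg /tl [e e0 He]; exists e => // r /He.
by rewrite /quarter_turn /= !mulrN; congr (0 < sg * _); ring.
Qed.

Lemma weighted_quarter_turn t w H : weighted t w H ->
  weighted (t.2, t.1) w (quarter_turn H).
Proof. by move=> hw r x y; rewrite /quarter_turn /= -mulrN hw. Qed.

(** Two rays of the half-plane x > 0 across which the flow enters the sector
    between them would trap an orbit in that half-plane. *)
Lemma inward_rays_absurd t H f g (k1 k2 : R) : (0 < t.1)%N -> (0 < t.2)%N ->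
  turns_like t H f g -> monodromic f g -> k1 < k2 -> 0 < H 1 k1 -> H 1 k2 < 0 -> False.
Proof.
move=> t10 t20 tl mono k12 H1 H2.
have [|e1 e10 He1] := tl 1 k1 1; first by rewrite mul1r.
have [|e2 e20 He2] := tl 1 k2 (-1); first by rewrite mulN1r oppr_gt0.
pose e := Num.min e1 e2; have e0 : 0 < e by rewrite lt_min e10.
have [d d0 Hd] := mono (e ^+ t.1) (exprn_gt0 _ e0).
pose k := (k1 + k2) / 2.
have kk0 : 0 < 1 + k ^+ 2 by rewrite ltr_wpDr ?sqr_ge0.
pose r := Num.min (1 / 2) (d / (2 * (1 + k ^+ 2))).
have r0 : 0 < r by rewrite lt_min !divr_gt0 // mulr_gt0.
have r1 : r <= 1 by rewrite ge_min; apply/orP; left; lra.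
have rd : r * (1 + k ^+ 2) < d.
  have : r <= d / (2 * (1 + k ^+ 2)) by rewrite ge_min lexx orbT.
  rewrite -(ler_pM2r kk0) => /le_lt_trans; apply.
  have -> : d / (2 * (1 + k ^+ 2)) * (1 + k ^+ 2) = d / 2 by field; rewrite gt_eqF.
  lra.
have pw n : (0 < n)%N -> 0 < r ^+ n <= r.
  move=> n0; rewrite exprn_gt0 //= -[leRHS]expr1; apply: ler_wiXn2l => //; exact: ltW.
have /andP[p1 p1'] := pw _ t10; have /andP[p2 p2'] := pw _ t20.
have [|T [x [y [rho [theta [[T0 [x0 y0] [cx cy D]] [cth K turn]]]]]]] :=
    Hd (r ^+ t.1) (r ^+ t.2 * k).
  rewrite ltr_wpDr ?sqr_ge0 ?exprn_gt0 //=.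
  apply: (@le_lt_trans _ _ ((r * (1 + k ^+ 2)) ^+ 2)); last first.
    by rewrite ltrXn2r // ltW // mulr_gt0.
  rewrite exprMn [leRHS]exprMn.
  have h1 : (r ^+ t.1) ^+ 2 <= r ^+ 2 by rewrite lerXn2r // nnegrE ltW.
  have h2 : (r ^+ t.2) ^+ 2 <= r ^+ 2 by rewrite lerXn2r // nnegrE ltW.
  have k20 := sqr_ge0 k; have r20 := sqr_ge0 r.
  apply: (le_trans (lerD h1 (ler_wpM2r k20 h2))).
  have -> : r ^+ 2 + r ^+ 2 * k ^+ 2 = r ^+ 2 * (1 + k ^+ 2) by ring.
  by apply: ler_wpM2l => //; rewrite expr2; apply: ler_peMl; [exact: ltW|rewrite lerDl].
pose c s := Num.max 0 (Num.min s T).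
have cE s : 0 <= s <= T -> c s = s.
  by move=> /andP[s0 sT]; rewrite /c (min_idPl sT); apply/max_idPr.
have DX s : 0 < s < T -> is_derive s 1 (fun s => x (c s)) (f (x s) (y s)) /\
    is_derive s 1 (fun s => y (c s)) (g (x s) (y s)).
  move=> sT; have [Dx Dy] := D s sT.
  have nr : \forall v \near s, c v = v.
    have sin : s \in `]0, T[ by rewrite in_itv.
    have := near_in_itvoo sin; apply: filterS => v /=; rewrite in_itv /= => /andP[v0 vT].
    by apply: cE; rewrite !ltW.
  by split; [apply: near_eq_is_derive Dx|apply: near_eq_is_derive Dy];
    apply: filterS nr => v ->.
have T00 : 0 <= (0 : R) <= T by rewrite lexx ltW.
have small s : 0 <= s <= T -> 0 < x s -> exists2 q, 0 < q < e & q ^+ t.1 = x s /\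
    q ^+ t.2 = ratpow t.1 t.2 (x s).
  move=> sT xs; exists (expR (ln (x s) / t.1%:R)); last first.
    have t1n : t.1%:R != 0 :> R by rewrite pnatr_eq0 -lt0n.
    split; rewrite -expRM_natl.
      by rewrite mulrC divfK // lnK.
    by rewrite /ratpow; congr expR; ring.
  rewrite expR_gt0 /=; have [/andP[rho0 rhoe] xE _] := K s sT.
  rewrite -(@ltr_pXn2r _ t.1) ?nnegrE ?expR_ge0 ?(ltW e0) //.
  rewrite -expRM_natl mulrC divfK ?pnatr_eq0 -?lt0n // lnK ?posrE //.
  apply: le_lt_trans rhoe; rewrite xE -[leRHS]mulr1 ler_wpM2l ?cos_le1 //; exact: ltW.
have xpos : forall s, 0 <= s <= T -> 0 < x s.
  move=> s sT; rewrite -(cE s sT).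
  apply: (@sector_trap R t.1 t.2 T k1 k2 (fun s => x (c s)) (fun s => y (c s))
    (fun s => f (x s) (y s)) (fun s => g (x s) (y s))) => //.
  - exact: clamped_continuous (ltW T0) cx.
  - exact: clamped_continuous (ltW T0) cy.
  - move=> v vT; rewrite cE //; have [/andP[rho0 _] -> ->] := K v vT.
    by rewrite !exprMn -mulrDr cos2Dsin2 mulr1 exprn_gt0.
  - move=> v vT; have vT' : 0 <= v <= T by case/andP: vT => *; rewrite !ltW.
    rewrite cE // => xv yv; have [q /andP[q0 qe] [q1 q2]] := small v vT' xv.
    have := He1 q; rewrite q0 /= (lt_le_trans qe) ?ge_min ?lexx // => /(_ erefl).
    by rewrite mul1r mulr1 q1 q2 [_ * k1]mulrC -yv.
  - move=> v vT; have vT' : 0 <= v <= T by case/andP: vT => *; rewrite !ltW.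
    rewrite cE // => xv yv; have [q /andP[q0 qe] [q1 q2]] := small v vT' xv.
    have := He2 q; rewrite q0 /= (lt_le_trans qe) ?ge_min ?lexx ?orbT // => /(_ erefl).
    by rewrite mulN1r oppr_gt0 mulr1 q1 q2 [_ * k2]mulrC -yv.
  - by rewrite cE // x0.
  - rewrite cE // x0 y0.
    have -> : ratpow t.1 t.2 (r ^+ t.1) = r ^+ t.2.
      have rn : 0 <= ratpow t.1 t.2 (r ^+ t.1) by exact: expR_ge0.
      apply/eqP; rewrite -(@eqrXn2 _ t.1) ?exprn_ge0 ?(ltW r0) //.
      by rewrite ratpow_exp // -!exprM mulnC.
    by rewrite ![_ * r ^+ t.2]mulrC !ltr_pM2l // /k; apply/andP; split; lra.
have pi0 := pi_gt0 R.
have [|sg [s [sgE sT th]]] := turn_angle (ltW T0) cth turn (al := pi).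
  by apply/andP; split; lra.
have [/andP[rs0 _] xs _] := K s sT; have [/andP[r00 _] xz _] := K 0 T00.
have cz : 0 < cos (theta 0) by have := xpos 0 T00; rewrite xz pmulr_rgt0.
have cs : 0 < cos (theta s) by have := xpos s sT; rewrite xs pmulr_rgt0.
have cE' : cos (theta s) = - cos (theta 0).
  rewrite th; case: sgE => ->; rewrite ?mul1r ?mulN1r.
    by rewrite cosD cospi sinpi; ring.
  by rewrite cosB cospi sinpi; ring.
by move: cs cz; rewrite cE'; lra.
Qed.

End Monodromy.

Section Propagation.
Variable R : realType.
Implicit Types (f g H : R -> R -> R) (t : nat * nat).

(** All that the propagation argument uses, in a form invariant under quarter turns.
    The last clause provides, in each open quadrant, a point from which the next
    half-plane can be reached. *)
Definition rotating t w H f g : Prop :=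
  [/\ (0 < t.1)%N /\ (0 < t.2)%N, weighted t w H, turns_like t H f g, monodromic f g &
      forall a b : R, a != 0 -> b != 0 -> exists x y, [/\ 0 < a * x, 0 < b * y & H x y != 0]].

Lemma rotating_quarter_turn t w H f g : rotating t w H f g ->
  rotating (t.2, t.1) w (quarter_turn H) (quarter_turn g) (fun x y => - quarter_turn f x y).
Proof.
move=> [[t10 t20] hw tl mono gen]; split => //.
- exact: weighted_quarter_turn.
- exact: turns_like_quarter_turn.
- exact: monodromic_quarter_turn.
- move=> a b a0 b0; have [|x [y [ax bY Hxy]]] := gen (- b) a _ a0.
    by rewrite oppr_eq0.
  by exists y, (- x); rewrite mulrN -mulNr /quarter_turn opprK.
Qed.

Lemma weighted_normalize t w H (x y : R) : (0 < t.1)%N -> weighted t w H -> 0 < x ->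
  exists2 q, 0 < q & H x y = q ^+ w * H 1 (y / q ^+ t.2).
Proof.
move=> t10 hw x0; exists (expR (ln x / t.1%:R)); first exact: expR_gt0.
have q0 n : expR (ln x / t.1%:R) ^+ n != 0 by rewrite expf_neq0 // gt_eqF // expR_gt0.
rewrite -hw mulr1 [_ * (y / _)]mulrC divfK // -expRM_natl mulrC divfK ?lnK //.
by rewrite pnatr_eq0 -lt0n.
Qed.

Lemma halfplane_step t w H f g (xa ya xb yb : R) : rotating t w H f g ->
  0 < xa -> ya <= 0 -> 0 < xb -> 0 <= yb -> ya < yb -> 0 < H xa ya -> 0 <= H xb yb.
Proof.
move=> [[t10 t20] hw tl mono _] xa0 ya0 xb0 yb0 yab Ha; rewrite leNgt; apply/negP => Hb.
have [qa qa0 Ea] := weighted_normalize ya t10 hw xa0.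
have [qb qb0 Eb] := weighted_normalize yb t10 hw xb0.
apply: (@inward_rays_absurd R t H f g (ya / qa ^+ t.2) (yb / qb ^+ t.2)) => //.
- have [ya1|ya1] := ltP ya 0.
    apply: (@lt_le_trans _ _ 0); first by rewrite pmulr_llt0 // invr_gt0 exprn_gt0.
    by rewrite divr_ge0 // exprn_ge0 // ltW.
  apply: (@le_lt_trans _ _ 0); first by rewrite pmulr_lle0 // invr_gt0 exprn_gt0.
  by rewrite divr_gt0 ?exprn_gt0 //; lra.
- by move: Ha; rewrite Ea pmulr_rgt0 // exprn_gt0.
- by move: Hb; rewrite Eb pmulr_rlt0 // exprn_gt0.
Qed.

Lemma quarter_step t w H f g (xa ya : R) : rotating t w H f g ->
  0 < xa -> ya <= 0 -> 0 < H xa ya ->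
  exists x y : R, [/\ 0 < x, 0 < y & 0 < H x y].
Proof.
move=> rot xa0 ya0 Ha; have [_ _ _ _ gen] := rot.
have [x [y]] := gen 1 1 (oner_neq0 _) (oner_neq0 _); rewrite !mul1r => -[x0 y0 Hxy].
exists x, y; split=> //; rewrite lt_neqAle eq_sym Hxy.
by apply: (halfplane_step rot xa0 ya0 x0 (ltW y0) _ Ha); exact: le_lt_trans y0.
Qed.

(** A positive value of H propagates counterclockwise from quadrant to quadrant,
    all the way around the origin. *)
Lemma rotating_semidefinite t w H f g (xa ya : R) : rotating t w H f g ->
  (xa, ya) != (0, 0) -> 0 < H xa ya ->
  forall x y, (x, y) != (0, 0) -> 0 <= H x y.
Proof.
have quad (x y : R) : (x, y) != (0, 0) ->
    [\/ 0 < x /\ 0 <= y, 0 < y /\ x <= 0, x < 0 /\ y <= 0 | y < 0 /\ 0 <= x].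
  rewrite xpair_eqE negb_and => /orP[|] z0; case: (ltrgtP x 0) => hx; case: (ltrgtP y 0) => hy;
    try (by rewrite ?hx ?hy eqxx in z0);
    first [by apply: Or41; lra|by apply: Or42; lra|by apply: Or43; lra|by apply: Or44; lra].
have open_quadrant t' H' f' g' (x0 y0 : R) : rotating t' w H' f' g' ->
    0 < x0 -> y0 < 0 -> 0 < H' x0 y0 -> forall x y, (x, y) != (0, 0) -> 0 <= H' x y.
  move=> rot x00 y00 H0.
  have rot1 := rotating_quarter_turn rot; have rot2 := rotating_quarter_turn rot1.
  have rot3 := rotating_quarter_turn rot2.
  have [x1 [y1 [x10 y10 H1]]] := quarter_step rot x00 (ltW y00) H0.
  have [|||x2 [y2 [x20 y20 H2]]] := @quarter_step _ _ _ _ _ y1 (- x1) rot1.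
  - by [].
  - by rewrite oppr_le0 ltW.
  - by rewrite /quarter_turn opprK.
  have [|||x3 [y3 [x30 y30 H3]]] := @quarter_step _ _ _ _ _ y2 (- x2) rot2.
  - by [].
  - by rewrite oppr_le0 ltW.
  - by rewrite /quarter_turn opprK.
  move=> x y /quad [] [h1 h2].
  - by apply: (halfplane_step rot x00 (ltW y00) h1 h2 _ H0); exact: lt_le_trans h2.
  - have := @halfplane_step _ _ _ _ _ y1 (- x1) y (- x) rot1 y10.
    rewrite {2}/quarter_turn opprK; apply => //; rewrite ?oppr_le0 ?oppr_ge0 ?(ltW x10) //.
      by lra.
    by rewrite /quarter_turn opprK.
  - have := @halfplane_step _ _ _ _ _ y2 (- x2) (- x) (- y) rot2 y20.
    rewrite {3 4}/quarter_turn !opprK; apply; rewrite ?oppr_le0 ?oppr_ge0 ?oppr_gt0 ?(ltW x20) //.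
      by lra.
    by move: H2; rewrite /quarter_turn opprK.
  - have := @halfplane_step _ _ _ _ _ y3 (- x3) (- y) x rot3 y30.
    rewrite {4 5 6}/quarter_turn !opprK; apply; rewrite ?oppr_le0 ?oppr_ge0 ?oppr_gt0 ?(ltW x30) //.
      by lra.
    by move: H3; rewrite /quarter_turn !opprK.
have half t' H' f' g' (x0 y0 : R) : rotating t' w H' f' g' ->
    0 < x0 -> y0 <= 0 -> 0 < H' x0 y0 -> forall x y, (x, y) != (0, 0) -> 0 <= H' x y.
  move=> rot x00 y00 H0; have [x1 [y1 [x10 y10 H1]]] := quarter_step rot x00 y00 H0.
  have rot1 := rotating_quarter_turn rot => x y xy.
  have := @open_quadrant _ _ _ _ y1 (- x1) rot1 y10 _ _ y (- x).
  rewrite /quarter_turn !opprK oppr_lt0; apply => //.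
  by move: xy; rewrite !xpair_eqE oppr_eq0 andbC.
move=> rot za Ha; have rot1 := rotating_quarter_turn rot.
have rot2 := rotating_quarter_turn rot1; have rot3 := rotating_quarter_turn rot2.
have flip (x y : R) : (x, y) != (0, 0) -> (y, - x) != (0, 0).
  by rewrite !xpair_eqE oppr_eq0 andbC.
have : [\/ 0 < xa /\ ya <= 0, 0 < ya /\ 0 <= xa, xa < 0 /\ 0 <= ya | ya < 0 /\ xa <= 0].
  have za' : (xa, - ya) != (0, 0) by move: za; rewrite !xpair_eqE oppr_eq0.
  by case: (quad _ _ za') => -[h1 h2]; [apply: Or41|apply: Or44|apply: Or43|apply: Or42]; lra.
case=> -[h1 h2] x y xy.
- exact: (half _ _ _ _ _ _ rot h1 h2 Ha).
- have := half _ _ _ _ ya (- xa) rot1 h1; rewrite oppr_le0 => /(_ h2).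
  rewrite /quarter_turn opprK => /(_ Ha y (- x) (flip _ _ xy)).
  by rewrite opprK.
- have := half _ _ _ _ (- xa) (- ya) rot2; rewrite oppr_gt0 oppr_le0 => /(_ h1 h2).
  rewrite /quarter_turn !opprK => /(_ Ha (- x) (- y)); rewrite !opprK; apply.
  by move: xy; rewrite !xpair_eqE !oppr_eq0.
- have := half _ _ _ _ (- ya) xa rot3; rewrite oppr_gt0 => /(_ h1 h2).
  rewrite /quarter_turn !opprK => /(_ Ha (- y) x); rewrite !opprK; apply.
  by move: xy; rewrite !xpair_eqE !oppr_eq0 andbC.
Qed.

End Propagation.

(** * Invariant axes and the equivalence *)

Section Assembly.
Variable R : realType.
Implicit Types (f g : R -> R -> R) (h p : {poly {poly R}}) (t : nat * nat).

(** Sliding (x, y) along its weighted ray into the unit box, the cross product is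
    rho ^ w b rho with b Lipschitz and b 0 = w h by Euler's identity. *)
Lemma blow_up_turns_like t (w : nat) f g h r1 K1 A1 r2 K2 A2 :
  (0 < t.1)%N -> (0 < t.2)%N -> (0 < w)%N -> quasihom t w%:Z h ->
  blow_up t t.2 w f (- map_poly (@deriv R) h) r1 K1 A1 ->
  blow_up t t.1 w g h^`() r2 K2 A2 ->
  turns_like t (fun x y => h.[x, y]) f g.
Proof.
move=> t10 t20 w0 hh [[/andP[r10 r11] K10] F1 L1 Z1] [[/andP[r20 r21] K20] F2 L2 Z2].
move=> x y sg pos.
pose T1 : R := t.1%:R; pose T2 : R := t.2%:R.
pose la := 1 + `|x| + `|y|; have la1 : 1 <= la by rewrite /la -addrA lerDl addr_ge0.
have la0 : 0 < la by apply: lt_le_trans la1.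
have lan n : (0 < n)%N -> la <= la ^+ n by move=> n0; rewrite -[leLHS]expr1 ler_weXn2l.
have la_n n : la ^+ n != 0 by rewrite expf_neq0 // gt_eqF.
pose x' := x / la ^+ t.1; pose y' := y / la ^+ t.2.
have norm1 z n : (0 < n)%N -> `|z| <= la -> `|z / la ^+ n| <= 1.
  move=> n0 zl; have ln0 : 0 < la ^+ n by rewrite exprn_gt0.
  by rewrite normrM normfV (ger0_norm (ltW ln0)) ler_pdivrMr // mul1r (le_trans zl) // lan.
have nx := normr_ge0 x; have ny := normr_ge0 y.
have x1 : `|x'| <= 1 by apply: norm1 => //; rewrite /la; lra.
have y1 : `|y'| <= 1 by apply: norm1 => //; rewrite /la; lra.
have xE : x = la ^+ t.1 * x' by rewrite mulrC divfK.
have yE : y = la ^+ t.2 * y' by rewrite mulrC divfK.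
pose b r := T1 * x' * A2 r x' y' - T2 * y' * A1 r x' y'.
have b0 : b 0 = w%:R * h.[x', y'].
  rewrite /b Z1 Z2 hornerN hornerN -(quasihom_euler x' y' hh).
  by rewrite mulrN opprK.
have be0 : 0 < sg * b 0.
  rewrite b0 mulrCA pmulr_rgt0 ?ltr0n //.
  move: pos; rewrite xE yE (quasihom_scale _ _ _ hh) mulrCA pmulr_rgt0 //.
  exact: exprn_gt0.
pose KB := `|sg| * (T1 * K2 + T2 * K1).
have T10 : 0 <= T1 by [].
have T20 : 0 <= T2 by [].
have KB0 : 0 <= KB by rewrite mulr_ge0 // addr_ge0 // mulr_ge0.
have KB1 : 0 < KB + 1 by rewrite ltr_wpDl.
pose e := Num.min (Num.min r1 r2) (sg * b 0 / (KB + 1)).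
have e0 : 0 < e by rewrite !lt_min r10 r20 divr_gt0.
exists (e / la) => [|r /andP[r0 re]]; first by rewrite divr_gt0.
pose rho := r * la.
have rho0 : 0 < rho by rewrite mulr_gt0.
have rhoe : rho < e by rewrite -ltr_pdivlMr.
have [rr1 rr2 rr3] : [/\ rho < r1, rho < r2 & rho < sg * b 0 / (KB + 1)].
  by move: rhoe; rewrite !lt_min => /andP[/andP[]].
have XE : r ^+ t.1 * x = rho ^+ t.1 * x' by rewrite xE exprMn mulrA.
have YE : r ^+ t.2 * y = rho ^+ t.2 * y' by rewrite yE exprMn mulrA.
rewrite XE YE.
have -> : t.1%:R * (rho ^+ t.1 * x') * g (rho ^+ t.1 * x') (rho ^+ t.2 * y') -
   t.2%:R * (rho ^+ t.2 * y') * f (rho ^+ t.1 * x') (rho ^+ t.2 * y') =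
   T1 * x' * (rho ^+ t.1 * g (rho ^+ t.1 * x') (rho ^+ t.2 * y')) -
   T2 * y' * (rho ^+ t.2 * f (rho ^+ t.1 * x') (rho ^+ t.2 * y')) by rewrite /T1 /T2; ring.
rewrite F1 //; last by rewrite rho0 ltW.
rewrite F2 //; last by rewrite rho0 ltW.
have -> : T1 * x' * (rho ^+ w * A2 rho x' y') - T2 * y' * (rho ^+ w * A1 rho x' y') =
  rho ^+ w * b rho by rewrite /b; ring.
rewrite mulrCA pmulr_rgt0 ?exprn_gt0 //.
have close : `|sg * (b rho - b 0)| <= KB * rho.
  have zz (z : R) : `|z - z| = 0 by rewrite subrr normr0.
  have l1 : `|A1 rho x' y' - A1 0 x' y'| <= K1 * rho.
    have := L1 rho 0 x' x' y' y'; rewrite !zz !addr0 subr0 (ger0_norm (ltW rho0)).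
    by apply; rewrite ?lexx ?(ltW rho0) ?(ltW r10) ?(ltW rr1).
  have l2 : `|A2 rho x' y' - A2 0 x' y'| <= K2 * rho.
    have := L2 rho 0 x' x' y' y'; rewrite !zz !addr0 subr0 (ger0_norm (ltW rho0)).
    by apply; rewrite ?lexx ?(ltW rho0) ?(ltW r20) ?(ltW rr2).
  rewrite normrM /KB -mulrA ler_wpM2l //.
  have -> : b rho - b 0 = T1 * (x' * (A2 rho x' y' - A2 0 x' y')) -
     T2 * (y' * (A1 rho x' y' - A1 0 x' y')) by rewrite /b; ring.
  apply: (le_trans (ler_normB _ _)).
  rewrite (normrM T1) (normrM T2) (ger0_norm T10) (ger0_norm T20) mulrDl -(mulrA T1) -(mulrA T2).
  by apply: lerD; apply: ler_wpM2l => //; rewrite normrM -[leRHS]mul1r; apply: ler_pM.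
move: rr3; rewrite ltr_pdivlMr // => rr3.
move: close; rewrite mulrBr ler_norml => /andP[h1 _].
have : KB * rho <= rho * (KB + 1).
  by rewrite [rho * _]mulrC; apply: ler_wpM2r; [exact: ltW|rewrite lerDl].
by move: rr3 h1; lra.
Qed.

Lemma nonzero_in_quadrant h (a b : R) : h != 0 -> a != 0 -> b != 0 ->
  exists x y, [/\ 0 < a * x, 0 < b * y & h.[x, y] != 0].
Proof.
move=> h0 a0 b0; apply: contrapT => H; move/eqP: h0; apply.
have inj (c : R) : c != 0 -> injective (fun n : nat => c * n.+1%:R).
  by move=> c0 m n /(mulfI c0)/eqP; rewrite eqr_nat => /eqP [].
apply: (bipoly_grid_eq0 (inj a a0) (inj b b0)) => m n.
apply/eqP/negPn/negP => hn; apply: H; exists (a * m.+1%:R), (b * n.+1%:R).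
have pos (c : R) k : c != 0 -> 0 < c * (c * k.+1%:R).
  by move=> c0; rewrite mulrA mulr_gt0 ?ltr0Sn // -expr2 exprn_even_gt0.
by split => //; exact: pos.
Qed.

Lemma formal_sum_weight t (k : int) p (u : nat -> {poly {poly R}}) c :
  quasihom t k p -> (forall n, quasihom t (k + n.+1%:Z) (u n)) -> formal_sum p u c ->
  (forall i j, c i j != 0 -> k <= (t.1 * i + t.2 * j)%N%:Z) /\
  (forall i j, (t.1 * i + t.2 * j)%N%:Z = k -> c i j = p`_i`_j).
Proof.
move=> hp hu fs.
have cE i j : exists N, c i j = p`_i`_j + \sum_(n < N) (u n)`_i`_j.
  by have [N _ H] := fs i j; exists N; apply: H => /=.
split=> i j; have [N ->] := cE i j.
  have [p0|/hp <- //] := eqVneq (p`_i`_j) 0.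
  by rewrite p0 add0r => /sum_neq0 [n] /hu ->; rewrite lerDl.
move=> wE; rewrite big1 ?addr0 // => n _; apply/eqP/negPn/negP => /hu.
by rewrite wE => /eqP; rewrite -[X in X == _]addr0 (inj_eq (addrI k)).
Qed.

(** With the weights (1, 1) and no shift, the blow-up is f itself after rescaling:
    f is Lipschitz near the origin, and it vanishes on the y-axis. *)
Lemma axis_bound f c : has_expansion f c -> (forall j, c 0%N j = 0) ->
  exists e K, [/\ 0 < e, 0 <= K &
    forall x y, `|x| < e -> `|y| < e -> `|f x y| <= K * `|x|].
Proof.
move=> exf c0; have [rho rho0 [_ fE]] := exf.
have [|||r1 [K [A [[/andP[r10 r11] K0] F L _]]]] := @blow_up_exists R (1, 1)%N 0 0 f c
   (monom (c 0%N 0%N) 0 0) isT isT exf.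
- exact: (@quasihom_monom R (1, 1)%N _ 0 0).
- by [].
- by move=> [|i] [|j] //= _; rewrite coef_monom.
pose e := Num.min r1 rho; have e0 : 0 < e by rewrite lt_min r10.
exists e, (K / r1); split=> //; first by rewrite divr_ge0 // ltW.
move=> x y; rewrite !lt_min => /andP[x1 x2] /andP[y1 y2].
have r1n : r1 != 0 by rewrite gt_eqF.
have f0y : f 0 y = 0.
  have := fE 0 y; rewrite normr0 => /(_ rho0 y2) h.
  have {}h : (fun n : nat => 0 : R) @ \oo --> f 0 y.
    apply: cvg_trans h; apply: near_eq_cvg; near=> n.
    rewrite big1 // => i _; rewrite big1 // => j _.
    case: i => [[|i] Hi] /=; first by rewrite c0 !mul0r.
    by rewrite expr0n /= mulr0 mul0r.
  by rewrite -(cvg_lim _ h) // lim_cst.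
have bnd z : `|z| < r1 -> `|z / r1| <= 1.
  by move=> z1; rewrite normrM normfV (gtr0_norm r10) ler_pdivrMr // mul1r ltW.
have rr : 0 < r1 <= r1 by rewrite r10 lexx.
have rr' : 0 <= r1 <= r1 by rewrite ltW // lexx.
have := F r1 (x / r1) (y / r1) rr (bnd x x1) (bnd y y1).
have := F r1 0 (y / r1) rr _ (bnd y y1); rewrite normr0 => /(_ ler01).
rewrite /= !expr0 !expr1 !mul1r mulr0 ![r1 * (_ / _)]mulrC !divfK // => f1 f2.
have := L r1 r1 (x / r1) 0 (y / r1) (y / r1) rr' rr' (bnd x x1) _ (bnd y y1) (bnd y y1).
rewrite normr0 => /(_ ler01); rewrite -f1 -f2 f0y !subrr !normr0 addr0 add0r !subr0.
by rewrite normrM normfV (gtr0_norm r10) [`|x| / _]mulrC mulrA.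
Unshelve. all: by end_near. Qed.

Lemma has_expansion_swap f c : has_expansion f c ->
  has_expansion (fun x y => f y x) (fun i j => c j i).
Proof.
move=> [rho rho0 [[M HM] H]]; exists rho => //; split.
  exists M => n; rewrite exchange_big /=; apply: le_trans (HM n).
  by apply: ler_sum => i _; apply: ler_sum => j _; rewrite addnC.
move=> x y x1 y1; have := H y x y1 x1.
rewrite (_ : (fun n => _) = (fun n => \sum_(i < n) \sum_(j < n) c j i * x ^+ i * y ^+ j)) //.
apply/funext => n; rewrite exchange_big /=; apply: eq_bigr => i _; apply: eq_bigr => j _.
by rewrite mulrAC.
Qed.

(** Along an orbit x^2 exp (- 2 K s) does not increase, so an orbit that starts on
    the y-axis stays on it and never makes a quarter turn. *)
Lemma invariant_axis_absurd f g (e K : R) : 0 < e -> 0 <= K ->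
  (forall x y, `|x| < e -> `|y| < e -> `|f x y| <= K * `|x|) -> ~ monodromic f g.
Proof.
move=> e0 K0 fK mono; have [d d0 Hd] := mono e e0.
have [|T [x [y [rho [theta [[T0 [x0 y0] [cx cy D]] [cth P turn]]]]]]] := Hd 0 (d / 2).
  rewrite expr0n add0r exprn_gt0 ?divr_gt0 //=; rewrite ltrXn2r // ?divr_ge0 ?ltW //.
  by lra.
have T00 : 0 <= (0 : R) <= T by rewrite lexx ltW.
have xy s : 0 <= s <= T -> `|x s| < e /\ `|y s| < e.
  move=> /P [/andP[r0 re] -> ->]; rewrite !normrM (gtr0_norm r0).
  by split; apply: le_lt_trans re; rewrite -[leRHS]mulr1 ler_wpM2l ?cos_max ?sin_max // ltW.
have xz s : 0 <= s <= T -> x s = 0.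
  move=> /andP[s0 sT]; pose E (v : R) := 1 * expR (- (2 * K) * v).
  have cE : continuous E by move=> v; exact: is_derive_continuous (is_derive_expM _ _ _).
  have cxs : {within `[0, s], continuous x}.
    by apply: continuous_subspaceW cx; apply: subset_itvl; rewrite bnd_simp.
  have cF : {within `[0, s], continuous (fun v => x v * x v * E v)}.
    apply: within_continuousM; first exact: within_continuousM.
    exact: continuous_subspaceT.
  have DF v : v \in `]0, s[ -> is_derive v 1 (fun v => x v * x v * E v)
      (2 * (x v * f (x v) (y v) - K * (x v * x v)) * E v).
    rewrite in_itv /= => /andP[v0 vs]; have [|Dx _] := D v.
      by rewrite v0 (lt_le_trans vs).
    apply: (is_derive_pt (is_deriveM (is_deriveM Dx Dx) (is_derive_expM 1 (- (2 * K)) v))) => //.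
    by rewrite /GRing.scale /E /= !fctE; ring.
  have [v vI] := MVT_segment s0 DF cF.
  have vT : 0 <= v <= T.
    by move: vI; rewrite in_itv /= => /andP[-> vs]; rewrite (le_trans vs).
  rewrite x0 !mul0r subr0 subr0 => e1.
  have [xv yv] := xy v vT.
  have xf : x v * f (x v) (y v) <= K * (x v * x v).
    apply: (le_trans (ler_norm _)); rewrite normrM.
    have -> : x v * x v = `|x v| * `|x v| by rewrite -normrM ger0_norm // -expr2 sqr_ge0.
    by rewrite mulrCA ler_wpM2l // fK.
  have Ep z : 0 < E z by rewrite /E mul1r expR_gt0.
  have le0 : x s * x s * E s <= 0.
    by rewrite e1 mulr_le0_ge0 // mulr_le0_ge0 ?(ltW (Ep _)) // pmulr_rle0 // subr_le0.
  move: le0; rewrite pmulr_lle0 // -expr2 => le0.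
  by apply/eqP; rewrite -sqrf_eq0 eq_le le0 sqr_ge0.
have pi0 := pi_gt0 R.
have [|sg [s [sgE sT th]]] := turn_angle (ltW T0) cth turn (al := pi / 2).
  by apply/andP; split; lra.
have [/andP[rs0 _] xs _] := P s sT; have [/andP[r00 _] xz0 _] := P 0 T00.
have c0 : cos (theta 0) = 0.
  by move/eqP: xz0; rewrite xz // eq_sym mulf_eq0 gt_eqF //= => /eqP.
have cs : cos (theta s) = 0.
  by move/eqP: xs; rewrite xz // eq_sym mulf_eq0 gt_eqF //= => /eqP.
have sn : sin (theta 0) = 0.
  move: cs; rewrite th; case: sgE => ->; rewrite ?mul1r ?mulN1r.
    by rewrite cosDpihalf => /eqP; rewrite oppr_eq0 => /eqP.
  by rewrite cosBpihalf.
have := cos2Dsin2 (theta 0); rewrite c0 sn expr0n addr0 => /eqP.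
by rewrite eq_sym oner_eq0.
Qed.

End Assembly.

Theorem proposition3 (R : realType) (t : nat * nat) (r : int)
    (h : {poly {poly R}}) (f g : R -> R -> R) :
  is_type t ->
  r + twt t != 0 ->
  Fclass t r (complexify h) ->
  hamiltonian_plus_hot t r h f g ->
  f 0 0 = 0 -> g 0 0 = 0 ->
  (monodromic f g <-> vanishes_only_at_origin h).
Proof.
move=> /andP[t00 cop] rt0 [hq simp _] [u [v [uv [[c exf fsf] [d exg fsg]]]]] _ _.
have hh := quasihom_complexify hq.
have h0 : h != 0.
  by case: simp => + _; apply: contra_neq => ->; rewrite /complexify map_poly0.
have [w wE w0] : exists2 w : nat, r + twt t = w%:Z & (0 < w)%N.
  have [i [j hij]] : exists i j, h`_i`_j != 0.
    exists (size h).-1, (size (lead_coef h)).-1.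
    by rewrite -[_`_(size h).-1]/(lead_coef h) -[_`_(_).-1]/(lead_coef _) !lead_coef_eq0.
  exists (t.1 * i + t.2 * j)%N; first by rewrite (hh i j hij).
  by rewrite lt0n; move: rt0; rewrite -(hh i j hij).
rewrite wE in hh.
have rw : r = w%:Z - t.1%:Z - t.2%:Z by move: wE; rewrite /twt; lia.
have hu n : quasihom t (w%:Z - t.2%:Z + n.+1%:Z) (u n).
  have [/quasihom_complexify hu _] := uv n; rewrite (_ : _ + _ = r + n.+1%:Z + t.1%:Z) //.
  by rewrite rw; lia.
have hv n : quasihom t (w%:Z - t.1%:Z + n.+1%:Z) (v n).
  have [_ /quasihom_complexify hv] := uv n; rewrite (_ : _ + _ = r + n.+1%:Z + t.2%:Z) //.
  by rewrite rw; lia.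
have [cge ceq] := formal_sum_weight (quasihomN (quasihom_dY hh)) hu fsf.
have [dge deq] := formal_sum_weight (quasihom_dX hh) hv fsg.
have h00 : h.[0, 0] = 0.
  have := quasihom_scale 0 0 0 hh; rewrite !mulr0 => ->.
  by rewrite expr0n gtn_eqF // mul0r.
have [t1z|t10] := posnP t.1.
  (* The type is (0, 1), and the x-axis is invariant. *)
  have t2E : t.2 = 1%N by move: cop; rewrite t1z /coprime gcd0n => /eqP.
  split=> [mono|van]; last first.
    have := quasihom_scale 0 1 0 hh; rewrite t1z t2E expr0 expr1 mul1r mul0r expr0n gtn_eqF //.
    by rewrite mul0r => /van [/eqP]; rewrite oner_eq0.
  exfalso; have d0 i : d i 0%N = 0.
    apply/eqP/negPn/negP => /dge; rewrite t1z t2E muln0 mul0n; lia.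
  have [e [K [e0 K0 H]]] := axis_bound (has_expansion_swap exg) d0.
  apply: (invariant_axis_absurd e0 K0 _ (monodromic_quarter_turn mono)) => x y xe ye.
  by rewrite /quarter_turn; apply: H; rewrite ?normrN.
have [t2z|t20] := posnP t.2.
  (* The type is (1, 0), and the y-axis is invariant. *)
  have t1E : t.1 = 1%N by move: cop; rewrite t2z /coprime gcdn0 => /eqP.
  split=> [mono|van]; last first.
    have := quasihom_scale 0 0 1 hh; rewrite t2z t1E expr0 expr1 mul1r mul0r expr0n gtn_eqF //.
    by rewrite mul0r => /van [_ /eqP]; rewrite oner_eq0.
  exfalso; have c0 j : c 0%N j = 0.
    apply/eqP/negPn/negP => /cge; rewrite t1E t2z muln0 mul0n; lia.
  have [e [K [e0 K0 H]]] := axis_bound exf c0.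
  exact: (invariant_axis_absurd e0 K0 H mono).
have [|||r1 [K1 [A1 bu1]]] := @blow_up_exists R t t.2 w f c (- map_poly (@deriv R) h) t10 t20 exf.
- exact/quasihomN/quasihom_dY.
- by move=> i j /cge; lia.
- by move=> i j E; apply: ceq; lia.
have [|||r2 [K2 [A2 bu2]]] := @blow_up_exists R t t.1 w g d h^`() t10 t20 exg.
- exact: quasihom_dX.
- by move=> i j /dge; lia.
- by move=> i j E; apply: deq; lia.
split=> [mono x y|van]; last first.
  apply: (definite_monodromic t10 t20 w0 hh bu1 bu2) => a b ab.
  apply/eqP => /van [a0 b0]; move: ab; rewrite a0 b0 expr0n addr0 => /eqP.
  by rewrite eq_sym oner_eq0.
split=> [hz|[-> ->]] //; apply: contrapT => nz.
have xy0 : (x, y) != (0, 0) by apply/eqP => -[x0 y0]; apply: nz.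
have rot : rotating t w (fun x y => h.[x, y]) f g.
  split=> //; first by move=> s a b; exact: quasihom_scale.
    exact: blow_up_turns_like bu1 bu2.
  by move=> a b a0 b0; exact: nonzero_in_quadrant.
have [a [b hab]] : exists a b : R, 0 < h.[a, b].
  apply: contrapT => H; apply: (simple_factors_indefinite t10 t20 cop (quasihomN hh) _ xy0).
  - by rewrite /complexify rmorphN; exact: simple_factorsN.
  - by rewrite !hornerN hz oppr0.
  move=> a b; rewrite !hornerN oppr_ge0 leNgt; apply/negP => hab.
  by apply: H; exists a, b.
apply: (simple_factors_indefinite t10 t20 cop hh simp xy0 hz) => x' y'.
have [[-> ->]|xy'] := eqVneq (x', y') (0, 0); first by rewrite h00.
apply: (rotating_semidefinite rot _ hab) => //.
by apply: contraTneq hab => -[-> ->]; rewrite h00 ltxx.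
Qed.
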